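(* Let $\Phi:\mathbb{R}^+\to\mathbb{R}^+$, let $f:\Pi\to\overline{\Pi}$ be analytic, and let $\tau\in\mathbb{R}$. Then $f$ is $\Phi$-fortunate at $\tau$ if and only if the Nevanlinna measure $\mu_f$ has sub-$\Phi$-density at $\tau$. Moreover, in such a case there exists $C>0$ such that for every pair of functions $\mathfrak{k},\lambda:\mathbb{R}^+\to\mathbb{R}^+$ satisfying (1) $\Phi(Ct)=(\mathfrak{k}\circ\lambda)(t)$ for all $t>0$, (2) $\dfrac{\lambda(\varepsilon)}{\Phi(C\varepsilon)\varepsilon^2}$ is bounded as $\varepsilon\to0$, and (3) $\lambda(t)$ is $O(t)$ as $t\to0$, we have $\limsup_{\varepsilon\to0}A\mathfrak{F}^{\mathfrak{k},\tau}_{f,\lambda}(\varepsilon)<\infty$.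
   Context: $\Pi$ is the open upper half plane in $\mathbb{C}$, $\overline{\Pi}=\{z\in\mathbb{C}:\operatorname{Im}z\ge0\}$, and $\mathbb{R}^+=(0,\infty)$. For analytic $f:\Pi\to\overline{\Pi}$, the Nevanlinna measure $\mu_f$ is the positive Borel measure on $\mathbb{R}$ that is the weak limit (against compactly supported continuous functions) of the measures $\operatorname{Im}f(x+iy)\,dx$ as $y\to0^+$. For $\mathfrak{k}:\mathbb{R}^+\to\mathbb{R}^+$ put $\mathfrak{F}^{\mathfrak{k}}_f(z)=\operatorname{Im}f(z)/\mathfrak{k}(\operatorname{Im}z)$ and, for $\lambda:\mathbb{R}^+\to\mathbb{R}^+$ and $\varepsilon>0$, $A\mathfrak{F}^{\mathfrak{k},\tau}_{f,\lambda}(\varepsilon)=\frac{1}{2\varepsilon}\int_{-\varepsilon}^{\varepsilon}\mathfrak{F}^{\mathfrak{k}}_f(\tau+x+i\lambda(\varepsilon))\,dx$. ''$\lambda$ is $O(t)$ as $t\to0$'' means there are $k,\delta>0$ with $\lambda(t)\le kt$ for $0<t<\delta$. $f$ is $\Phi$-fortunate at $\tau$ if there exist $C>0$ and functions $\mathfrak{k},\lambda:\mathbb{R}^+\to\mathbb{R}^+$ such that $\Phi(Ct)=(\mathfrak{k}\circ\lambda)(t)$ for all $t>0$, $\lambda$ is $O(t)$ as $t\to0$, $\frac{\lambda(\varepsilon)}{\Phi(C\varepsilon)\varepsilon^2}$ is bounded as $\varepsilon\to0$, and $\limsup_{\varepsilon\to0}A\mathfrak{F}^{\mathfrak{k},\tau}_{f,\lambda}(\varepsilon)<\infty$.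 A measure $\mu$ has sub-$\Phi$-density at $\tau$ if there is $C>0$ such that $\frac{\mu((\tau-\varepsilon,\tau+\varepsilon))}{\Phi(C\varepsilon)\varepsilon}$ is bounded as $\varepsilon\to0$. *)

(* Defs.v *)
From HB Require Import structures.
From mathcomp Require Import all_boot all_order all_algebra.
From mathcomp Require Import complex.
From mathcomp Require Import all_classical all_reals all_analysis.

Set Implicit Arguments.
Unset Strict Implicit.
Unset Printing Implicit Defensive.

Import Order.TTheory GRing.Theory Num.Theory.
Import numFieldNormedType.Exports.

Local Open Scope classical_set_scope.
Local Open Scope ring_scope.
Local Open Scope complex_scope.

(* Functions on (0, oo), or on the upper half plane, are total functions whose
   values outside that domain are never used. *)

Section Defs.
Context {R : realType}.

Definition upper_half_plane : set R[i] := [set z | 0 < complex.Im z].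

Definition closed_upper_half_plane : set R[i] := [set z | 0 <= complex.Im z].

(* Complex differentiability at every point of the open set D: the limit
   defining the derivative is taken over h : R[i] tending to 0, with R[i]^o the
   one-dimensional normed space R[i] over the field R[i]. *)
Definition analytic_on (D : set R[i]) (f : R[i] -> R[i]) : Prop :=
  forall z, D z -> derivable (f : (R[i])^o -> (R[i])^o) z 1.

Definition positive_fun (g : R -> R) : Prop := forall t, 0 < t -> 0 < g t.

Definition compactly_supported (phi : R -> R) : Prop :=
  compact (closure [set x | phi x != 0]).

Definition nevanlinna_measure (f : R[i] -> R[i])
    (mu : {measure set (measurableTypeR R) -> \bar R}) : Prop :=
  forall phi : R -> R, continuous phi -> compactly_supported phi ->
    mu.-integrable setT (EFin \o phi) /\
    (fun y => \int[lebesgue_measure]_x (phi x * complex.Im (f (x +i* y)))%:E)%E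
      @ 0^'+ --> (\int[mu]_x (phi x)%:E)%E.

Definition fF (k : R -> R) (f : R[i] -> R[i]) (z : R[i]) : R :=
  complex.Im (f z) / k (complex.Im z).

Definition AfF (k lambda : R -> R) (f : R[i] -> R[i]) (tau e : R) : \bar R :=
  (((2 * e)^-1)%:E *
   \int[lebesgue_measure]_(x in `[(- e)%R, e]) (fF k f ((tau + x) +i* lambda e))%:E)%E.

Definition limsup_AfF_finite (k lambda : R -> R) (f : R[i] -> R[i]) (tau : R) :
    Prop :=
  (limf_esup (AfF k lambda f tau) 0^'+ < +oo)%E.

Definition is_Ot (lambda : R -> R) : Prop :=
  exists k delta : R, [/\ 0 < k, 0 < delta &
    forall t, 0 < t < delta -> lambda t <= k * t].

Definition lambda_ratio_bounded (Phi : R -> R) (C : R) (lambda : R -> R) : Prop :=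
  bounded_near (fun e : R => lambda e / (Phi (C * e) * e ^+ 2) : R^o) 0^'+.

Definition fortunate (Phi : R -> R) (f : R[i] -> R[i]) (tau : R) : Prop :=
  exists C : R, exists k lambda : R -> R,
    [/\ 0 < C, positive_fun k & positive_fun lambda] /\
    [/\ forall t, 0 < t -> Phi (C * t) = k (lambda t),
        is_Ot lambda,
        lambda_ratio_bounded Phi C lambda &
        limsup_AfF_finite k lambda f tau].

(* The bound is stated in \bar R because mu is \bar R-valued. *)
Definition sub_density (Phi : R -> R)
    (mu : {measure set (measurableTypeR R) -> \bar R}) (tau : R) : Prop :=
  exists2 C : R, 0 < C &
    exists M : R, \forall e \near 0^'+,
      (mu `](tau - e)%R, (tau + e)%R[%classic * ((Phi (C * e) * e)^-1)%:E <= M%:E)%E.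

End Defs.

(* Main.v *)
Require Import Defs.
From HB Require Import structures.
From mathcomp Require Import all_boot all_order all_algebra.
From mathcomp Require Import complex.
From mathcomp Require Import all_classical all_reals all_analysis.
From mathcomp Require Import measurable_realfun ring lra.

Import Order.TTheory GRing.Theory Num.Theory.
Import numFieldNormedType.Exports.

Local Open Scope classical_set_scope.
Local Open Scope ring_scope.
Local Open Scope complex_scope.

(** Write q = Im f >= 0. Both implications compare the mass of mu near tau with
    the integral of q over a short horizontal segment at height lambda(e), which
    is classically done with the Poisson kernel. Here the Nevanlinna
    representation is replaced by differential inequalities in the height y.
    Take the bump phi(x) = (1 - ((x - tau)/a)^2)^3, supported in
    [tau - a, tau + a], and put U(y) = int phi(x) q(x + i y) dx ([mass]). As q
    is harmonic and phi is of class C^2, U''(y) = - int phi'' q; as y tends to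
    0, U(y) tends to int phi dmu ([boundary_mass], [mass_cvg]), which lies between
    27/64 mu((tau - a/2, tau + a/2)) and mu((tau - a, tau + a)).

    A lower bound for U. Since - phi'' <= (3/a)^2 phi, one has U'' <= (3/a)^2 U,
    and a nonnegative solution of this inequality on the whole half-line decays
    no faster than exp(- 3 y / a): int phi dmu <= exp(3 z / a) U(z) for every
    z > 0 ([boundary_mass_growth]). With a = e and z = lambda(e) = O(e) the
    exponential is bounded, so a bound on the averages of Im f bounds mu: this is
    [fortunate_sub_density].

    An upper bound for U. The integral of q over [tau - 1, tau + 1] stays
    bounded as y decreases to 0, by weak convergence ([segint_bounded]). Hence
    U'' >= - s with s of order 1/a^2, and U(y) + s y^2 / 2 is convex; its chord
    up to a height h of order a gives U(z) <= int phi dmu + O(z / a)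
    ([boundary_mass_chord]). With a = 2 e and z = lambda(e), the first term is
    controlled by the density of mu and the second one by the boundedness of
    lambda(e) / (Phi(C e) e^2): this is [sub_density_limsup]. To deduce that f is
    fortunate one still has to exhibit a pair (k, lambda) with
    Phi(C t) = k(lambda(t)); as Phi is arbitrary, lambda is taken injective,
    below a prescribed positive function ([injective_minorant]).

    Analyticity of f enters through the formula for U''. It means pointwise
    complex differentiability, so the partial derivatives of f need not be
    integrable a priori. Goursat's theorem on rectangles ([circulation_eq0])
    avoids them: the derivative of an integral of f against a weight follows
    from it by parts ([is_derive_weighted_segint]). *)

(** * Integrals over segments, and Goursat's theorem on rectangles *)

Section segment_integral.
Context {R : realType}.
Implicit Types (a b : R) (g : R -> R).

Definition segint a b g : R := \int[lebesgue_measure]_(x in `[a, b]) g x.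

Lemma segment_integrable a b g : {within `[a, b], continuous g} ->
  lebesgue_measure.-integrable `[a, b] (EFin \o g).
Proof.
by move=> cg; apply: continuous_compact_integrable => //; exact: segment_compact.
Qed.

Lemma segint_chasles a m b g : a <= m <= b -> {within `[a, b], continuous g} ->
  segint a b g = segint a m g + segint m b g.
Proof.
move=> /andP[am mb] cg; have ig := segment_integrable a b g cg.
have := @Rintegral_itvB R g (BLeft a) (BRight b) m ig.
rewrite !bnd_simp => /(_ am mb) H.
apply/eqP; rewrite /segint addrC -subr_eq H; apply/eqP.
rewrite Rintegral_itv_obnd_cbnd//.
apply: integrableS ig => //.
by apply: subset_itv => //; rewrite bnd_simp.
Qed.

Lemma segint_cst a b (k : R) : a <= b -> segint a b (fun=> k) = k * (b - a).
Proof.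
move=> ab; rewrite /segint Rintegral_cst//= lebesgue_measure_itv/= lte_fin.
case: ltP => [//|ba]; have -> : a = b by apply/eqP; rewrite eq_le ab.
by rewrite subrr.
Qed.

Lemma segint_cont_le a b g1 g2 : {within `[a, b], continuous g1} ->
  {within `[a, b], continuous g2} -> (forall x, a <= x <= b -> g1 x <= g2 x) ->
  segint a b g1 <= segint a b g2.
Proof.
by move=> c1 c2 le12; apply: le_Rintegral => //; exact: segment_integrable.
Qed.

Lemma segintB a b g1 g2 : {within `[a, b], continuous g1} ->
  {within `[a, b], continuous g2} ->
  segint a b (fun x => g1 x - g2 x) = segint a b g1 - segint a b g2.
Proof. by move=> c1 c2; apply: RintegralB => //; exact: segment_integrable. Qed.

Lemma segintD a b g1 g2 : {within `[a, b], continuous g1} ->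
  {within `[a, b], continuous g2} ->
  segint a b (fun x => g1 x + g2 x) = segint a b g1 + segint a b g2.
Proof. by move=> c1 c2; apply: RintegralD => //; exact: segment_integrable. Qed.

Lemma segintZ a b (k : R) g : {within `[a, b], continuous g} ->
  segint a b (fun x => k * g x) = k * segint a b g.
Proof. by move=> cg; apply: RintegralZl => //; exact: segment_integrable. Qed.

Lemma eq_segint a b g1 g2 : (forall x, a <= x <= b -> g1 x = g2 x) ->
  segint a b g1 = segint a b g2.
Proof.
by move=> e; apply: eq_Rintegral => x; rewrite inE/= in_itv/=; exact: e.
Qed.

Lemma within_continuous_cst a b (k : R) : {within `[a, b], continuous (fun=> k)}.
Proof. by apply: continuous_subspaceT => x; exact: cvg_cst. Qed.

Lemma within_continuousB a b g1 g2 : {within `[a, b], continuous g1} ->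
  {within `[a, b], continuous g2} ->
  {within `[a, b], continuous (fun x => g1 x - g2 x)}.
Proof. by move=> c1 c2 x; apply: cvgB; [exact: c1|exact: c2]. Qed.

(** The estimate by which differentiability bounds the integral along one side
    of a small rectangle. *)
Lemma segint_near_cst a b g (k e : R) : a <= b -> {within `[a, b], continuous g} ->
  (forall x, a <= x <= b -> `|g x - k| <= e) ->
  `|segint a b g - k * (b - a)| <= e * (b - a).
Proof.
move=> ab cg H; rewrite ler_norml -mulNr lerBrDr -mulrDl lerBlDr -mulrDl.
rewrite -!segint_cst//; apply/andP; split; apply: segint_cont_le => //;
  try exact: within_continuous_cst.
  by move=> x /H; rewrite ler_norml => /andP[]; lra.
by move=> x /H; rewrite ler_norml => /andP[]; lra.
Qed.

Lemma segint_sub_le a b a' b' g : a <= a' -> a' <= b' -> b' <= b ->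
  {within `[a, b], continuous g} -> (forall x, a <= x <= b -> 0 <= g x) ->
  segint a' b' g <= segint a b g.
Proof.
move=> aa' ab' bb' cg g0.
have ge0 u v : a <= u -> v <= b -> 0 <= segint u v g.
  move=> au vb; apply: Rintegral_ge0 => x /=; rewrite in_itv/= => /andP[ux xv].
  by rewrite g0// (le_trans au)//= (le_trans xv).
have a'b : a' <= b by exact: le_trans bb'.
rewrite (@segint_chasles a a' b) ?aa'//.
rewrite (@segint_chasles a' b' b) ?ab'//.
  by rewrite addrCA lerDl addr_ge0// ge0// (le_trans aa').
by apply: continuous_subspaceW cg; apply: subset_itv; rewrite bnd_simp.
Qed.

End segment_integral.

Section goursat.
Context {R : realType}.
Implicit Types (P Q : R -> R -> R) (a b c d x y : R).

(** Total differentiability at (x, y); the error is measured with the l1 norm of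
    the increment, which suits rectangles. *)
Definition has_gradient P x y (A B : R) := forall e : R, 0 < e ->
  exists2 r : R, 0 < r & forall x' y', `|x' - x| < r -> `|y' - y| < r ->
    `|P x' y' - P x y - (A * (x' - x) + B * (y' - y))|
      <= e * (`|x' - x| + `|y' - y|).

Lemma has_gradient_continuous P x y A B : has_gradient P x y A B ->
  (fun z : R * R => P z.1 z.2) z @[z --> (x, y)] --> P x y.
Proof.
move=> /(_ 1 ltr01)[r r0 H]; apply/cvgrPdist_le => /= e e0.
set M := 2 + `|A| + `|B|.
have M0 : 0 < M by rewrite /M; have := normr_ge0 A; have := normr_ge0 B; lra.
near=> z.
have e1 : `|z.1 - x| < e / (2 * M).
  rewrite distrC; near: z; apply: (cvgr_dist_lt (fst : R * R -> R)) => //.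
    by exact: cvg_fst.
  by rewrite divr_gt0// mulr_gt0.
have e2 : `|z.2 - y| < e / (2 * M).
  rewrite distrC; near: z; apply: (cvgr_dist_lt (snd : R * R -> R)) => //.
    by exact: cvg_snd.
  by rewrite divr_gt0// mulr_gt0.
have r1 : `|z.1 - x| < r.
  by rewrite distrC; near: z; apply: (cvgr_dist_lt (fst : R * R -> R)) => //; exact: cvg_fst.
have r2 : `|z.2 - y| < r.
  by rewrite distrC; near: z; apply: (cvgr_dist_lt (snd : R * R -> R)) => //; exact: cvg_snd.
have := H _ _ r1 r2; rewrite mul1r => H1.
have eM : e / (2 * M) * M = e / 2 by field; rewrite gt_eqF.
have hA : `|A * (z.1 - x)| <= `|A| * (e / (2 * M)) by rewrite normrM ler_wpM2l// ltW.
have hB : `|B * (z.2 - y)| <= `|B| * (e / (2 * M)) by rewrite normrM ler_wpM2l// ltW.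
move: hA hB H1; rewrite !ler_norml.
move: e1 e2 eM; set k := e / (2 * M) => e1 e2; rewrite /M => eM.
set u := A * _; set v := B * _ => /andP[? ?] /andP[? ?] /andP[? ?].
by apply/andP; split; lra.
Unshelve. all: by end_near. Qed.

Lemma has_gradient_continuous1 P x y A B : has_gradient P x y A B ->
  {for x, continuous (fun x => P x y)}.
Proof.
move=> /has_gradient_continuous gP.
apply: (@cvg_comp _ _ _ (fun x' => (x', y)) (fun z => P z.1 z.2) (nbhs x)
  (nbhs (x, y))) => //.
by apply: (@cvg_pair _ _ _ (nbhs x) (nbhs x) (nbhs y)) => //; exact: cvg_cst.
Qed.

Lemma has_gradient_continuous2 P x y A B : has_gradient P x y A B ->
  {for y, continuous (fun y => P x y)}.
Proof.
move=> /has_gradient_continuous gP.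
apply: (@cvg_comp _ _ _ (fun y' => (x, y')) (fun z => P z.1 z.2) (nbhs y)
  (nbhs (x, y))) => //.
by apply: (@cvg_pair _ _ _ (nbhs y) (nbhs x) (nbhs y)) => //; exact: cvg_cst.
Qed.

(** The integral of P dx + Q dy along the boundary of [a, b] x [c, d], traversed
    clockwise. *)
Definition circulation P Q a b c d : R :=
  segint a b (fun x => P x d - P x c) - segint c d (fun y => Q b y - Q a y).

Section circulation_cuts.
Variables (P Q : R -> R -> R) (a b c d : R).
Hypothesis cP : forall y, c <= y <= d ->
  {within `[a, b], continuous (fun x => P x y)}.
Hypothesis cQ : forall x, a <= x <= b ->
  {within `[c, d], continuous (fun y => Q x y)}.

Let cP2 y y' x x' : c <= y <= d -> c <= y' <= d -> a <= x -> x' <= b ->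
  {within `[x, x'], continuous (fun x => P x y - P x y')}.
Proof.
move=> yI yI' ax xb; apply: (@continuous_subspaceW _ _ _ `[a, b]).
  by apply: subset_itv; rewrite bnd_simp.
by apply: within_continuousB; exact: cP.
Qed.

Let cQ2 x x' y y' : a <= x <= b -> a <= x' <= b -> c <= y -> y' <= d ->
  {within `[y, y'], continuous (fun y => Q x y - Q x' y)}.
Proof.
move=> xI xI' cy yd; apply: (@continuous_subspaceW _ _ _ `[c, d]).
  by apply: subset_itv; rewrite bnd_simp.
by apply: within_continuousB; exact: cQ.
Qed.

Lemma circulation_cutx x m x' y y' : a <= x -> x <= m -> m <= x' -> x' <= b ->
  c <= y -> y <= y' -> y' <= d ->
  circulation P Q x x' y y' = circulation P Q x m y y' + circulation P Q m x' y y'.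
Proof.
move=> ax xm mx' x'b cy yy' y'd; rewrite /circulation.
have yI : c <= y <= d by rewrite cy (le_trans yy').
have y'I : c <= y' <= d by rewrite y'd (le_trans cy).
have am : a <= m by exact: le_trans xm.
have mb : m <= b by exact: le_trans x'b.
rewrite (@segint_chasles _ x m x') ?xm//; last exact: cP2.
have -> : segint y y' (fun y => Q x' y - Q x y) =
    segint y y' (fun y => Q m y - Q x y) + segint y y' (fun y => Q x' y - Q m y).
  rewrite -segintD; try by apply: cQ2; rewrite // ?am ?mb ?ax ?x'b
    ?(le_trans am mx') ?(le_trans xm mb).
  by apply: eq_segint => z _; ring.
by ring.
Qed.

Lemma circulation_cuty x x' y m y' : a <= x -> x <= x' -> x' <= b ->
  c <= y -> y <= m -> m <= y' -> y' <= d ->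
  circulation P Q x x' y y' = circulation P Q x x' y m + circulation P Q x x' m y'.
Proof.
move=> ax xx' x'b cy ym my' y'd; rewrite /circulation.
have xI : a <= x <= b by rewrite ax (le_trans xx').
have x'I : a <= x' <= b by rewrite x'b (le_trans ax).
have cm : c <= m by exact: le_trans ym.
have md : m <= d by exact: le_trans y'd.
rewrite (@segint_chasles _ y m y') ?ym//; last exact: cQ2.
have -> : segint x x' (fun x => P x y' - P x y) =
    segint x x' (fun x => P x m - P x y) + segint x x' (fun x => P x y' - P x m).
  rewrite -segintD; try by apply: cP2; rewrite // ?cm ?md ?cy ?y'd
    ?(le_trans cm my') ?(le_trans ym md).
  by apply: eq_segint => z _; ring.
by ring.
Qed.

(** Inner sides cancel, so the four quarters share the whole circulation and
    one of them has at least a quarter of it. *)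
Lemma circulation_quarter x y w h e : 0 <= w -> 0 <= h ->
  a <= x -> x + (w + w) <= b -> c <= y -> y + (h + h) <= d ->
  4 * e <= `|circulation P Q x (x + (w + w)) y (y + (h + h))| ->
  exists i j, [/\ x <= i, i + w <= x + (w + w), y <= j, j + h <= y + (h + h) &
    e <= `|circulation P Q i (i + w) j (j + h)|].
Proof.
move=> w0 h0 ax xb cy yd; rewrite !addrA in xb yd *.
have ? : x <= x + w by rewrite lerDl.
have ? : x + w <= x + w + w by rewrite lerDl.
have ? : y <= y + h by rewrite lerDl.
have ? : y + h <= y + h + h by rewrite lerDl.
have ? : a <= x + w by exact: (le_trans ax).
have ? : x + w <= b by exact: (le_trans _ xb).
have ? : c <= y + h by exact: (le_trans cy).
have ? : y + h <= d by exact: (le_trans _ yd).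
rewrite (@circulation_cutx x (x + w))//; last by rewrite -addrA lerDl addr_ge0.
rewrite !(@circulation_cuty _ _ y (y + h) (y + h + h))//.
have pigeon (t1 t2 t3 t4 : R) : `|t1| < e -> `|t2| < e -> `|t3| < e ->
    4 * e <= `|t1 + t2 + (t3 + t4)| -> e <= `|t4|.
  move=> h1 h2 h3 /le_trans /(_ (ler_normD _ _)).
  move: (ler_normD t1 t2) (ler_normD t3 t4) h1 h2 h3.
  by move: `|t1 + t2| `|t3 + t4| `|t1| `|t2| `|t3| `|t4|; clear; intros; lra.
move=> big.
have [f1|f1] := leP e `|circulation P Q x (x + w) y (y + h)|.
  by exists x, y; split.
have [f2|f2] := leP e `|circulation P Q x (x + w) (y + h) (y + h + h)|.
  by exists x, (y + h); split.
have [f3|f3] := leP e `|circulation P Q (x + w) (x + w + w) y (y + h)|.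
  by exists (x + w), y; split.
by exists (x + w), (y + h); split => //; exact: pigeon f1 f2 f3 big.
Qed.

(** The affine parts of P and Q have zero circulation because the form is closed
    at (X, Y), the same B being both P_y and Q_x; only the errors remain. *)
Lemma circulation_small X Y A B C e x y w h : 0 <= w -> 0 <= h ->
  a <= x -> x + w <= b -> c <= y -> y + h <= d ->
  (forall x' y', x <= x' <= x + w -> y <= y' <= y + h ->
    `|P x' y' - P X Y - (A * (x' - X) + B * (y' - Y))| <= e) ->
  (forall x' y', x <= x' <= x + w -> y <= y' <= y + h ->
    `|Q x' y' - Q X Y - (B * (x' - X) + C * (y' - Y))| <= e) ->
  `|circulation P Q x (x + w) y (y + h)| <= 2 * e * (w + h).
Proof.
move=> w0 h0 ax xb cy yd gP gQ.
have yn : y <= y + h <= y + h by rewrite lerDl h0 lexx.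
have y0 : y <= y <= y + h by rewrite lerDl h0 lexx.
have xn : x <= x + w <= x + w by rewrite lerDl w0 lexx.
have x0 : x <= x <= x + w by rewrite lerDl w0 lexx.
have yd' : y <= d by rewrite (le_trans _ yd)// lerDl.
have cy' : c <= y + h by rewrite (le_trans cy)// lerDl.
have xb' : x <= b by rewrite (le_trans _ xb)// lerDl.
have ax' : a <= x + w by rewrite (le_trans ax)// lerDl.
have bP : `|segint x (x + w) (fun x => P x (y + h) - P x y) -
    B * h * (x + w - x)| <= (e + e) * (x + w - x).
  apply: segint_near_cst; first by rewrite lerDl.
    by apply: cP2; rewrite // ?cy ?yd ?yd' ?cy'.
  move=> x' xI; have := gP x' _ xI yn; have := gP x' _ xI y0.
  rewrite !ler_norml => /andP[p1 p2] /andP[q1 q2].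
  by clear -p1 p2 q1 q2; apply/andP; split; lra.
have bQ : `|segint y (y + h) (fun y => Q (x + w) y - Q x y) -
    B * w * (y + h - y)| <= (e + e) * (y + h - y).
  apply: segint_near_cst; first by rewrite lerDl.
    by apply: cQ2; rewrite // ?ax ?xb ?xb' ?ax'.
  move=> y' yI; have := gQ _ y' xn yI; have := gQ _ y' x0 yI.
  rewrite !ler_norml => /andP[p1 p2] /andP[q1 q2].
  by clear -p1 p2 q1 q2; apply/andP; split; lra.
rewrite /circulation.
move: bP bQ; move: (segint x _ _) (segint y _ _) => I J.
rewrite !ler_norml => /andP[p1 p2] /andP[q1 q2].
by clear -p1 p2 q1 q2; apply/andP; split; lra.
Qed.

End circulation_cuts.

Lemma nested_segments (u v : nat -> R) : (forall n, 0 <= v n) ->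
  (forall n, u n <= u n.+1 /\ u n.+1 + v n.+1 <= u n + v n) ->
  exists z, forall n, u n <= z <= u n + v n.
Proof.
move=> v0 uv.
have mono n m : (n <= m)%N -> u n <= u m /\ u m + v m <= u n + v n.
  elim: m => [|m IH]; first by rewrite leqn0 => /eqP ->.
  rewrite leq_eqVlt => /predU1P[->//|/IH[i1 i2]].
  have [j1 j2] := uv m.
  by split; [exact: le_trans j1|exact: le_trans i2].
have uB n m : u m <= u n + v n.
  have [nm|mn] := leqP n m.
    by have [_ h] := mono _ _ nm; rewrite (le_trans _ h)// lerDl.
  by have [h _] := mono _ _ (ltnW mn); rewrite (le_trans h)// lerDl.
exists (sup (range u)) => n; apply/andP; split.
  apply: ub_le_sup; last by exists n.
  by exists (u n + v n) => _ [m _ <-]; exact: uB.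
apply: ge_sup; first by exists (u 0%N), 0%N.
by move=> _ [m _ <-]; exact: uB.
Qed.

(** Goursat's theorem. If the circulation were E > 0 in absolute value, repeated
    quartering would give rectangles shrinking to a point (X, Y), the n-th of
    which has circulation at least E / 4^n, whereas closedness and
    differentiability at (X, Y) make it o(1 / 4^n). *)
Lemma circulation_eq0 P Q a b c d : a <= b -> c <= d ->
  (forall x y, a <= x <= b -> c <= y <= d ->
    exists A B C, has_gradient P x y A B /\ has_gradient Q x y B C) ->
  circulation P Q a b c d = 0.
Proof.
move=> ab cd diffPQ.
have cP y : c <= y <= d -> {within `[a, b], continuous (fun x => P x y)}.
  move=> yI; apply/continuous_in_subspaceT => x; rewrite inE/= in_itv/= => xI.
  have [A [B [C [gP _]]]] := diffPQ x y xI yI.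
  exact: has_gradient_continuous1 gP.
have cQ x : a <= x <= b -> {within `[c, d], continuous (fun y => Q x y)}.
  move=> xI; apply/continuous_in_subspaceT => y; rewrite inE/= in_itv/= => yI.
  have [A [B [C [_ gQ]]]] := diffPQ x y xI yI.
  exact: has_gradient_continuous2 gQ.
apply/eqP/negP => /negP D0.
have [w wE] : exists w, w = b - a by exists (b - a).
have [h hE] : exists h, h = d - c by exists (d - c).
have w0 : 0 <= w by rewrite wE subr_ge0.
have h0 : 0 <= h by rewrite hE subr_ge0.
have [E EE] : exists E, E = `|circulation P Q a b c d| by eexists.
have E0 : 0 < E by rewrite EE normr_gt0.
have half (t : R) n : t / 2 ^+ n = t / 2 ^+ n.+1 + t / 2 ^+ n.+1.
  by rewrite exprS; field; rewrite expf_neq0.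
have half0 (t : R) n : 0 <= t -> 0 <= t / 2 ^+ n.
  by move=> t0; rewrite divr_ge0// exprn_ge0.
pose bad n (p : R * R) := [/\ a <= p.1 & p.1 + w / 2 ^+ n <= b] /\
  [/\ c <= p.2, p.2 + h / 2 ^+ n <= d & E / 4 ^+ n <=
   `|circulation P Q p.1 (p.1 + w / 2 ^+ n) p.2 (p.2 + h / 2 ^+ n)|].
have /choice[nxt nxtP] : forall np : nat * (R * R), exists p',
  bad np.1 np.2 -> [/\ bad np.1.+1 p', np.2.1 <= p'.1, np.2.2 <= p'.2,
        p'.1 + w / 2 ^+ np.1.+1 <= np.2.1 + w / 2 ^+ np.1 &
        p'.2 + h / 2 ^+ np.1.+1 <= np.2.2 + h / 2 ^+ np.1].
  move=> [n [x y]] /=; have [bp|nbp] := pselect (bad n (x, y)); last by exists (x, y).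
  case: bp => -[/=]; rewrite (half w n) (half h n) => ax xb [cy yd big].
  have E4 : 4 * (E / 4 ^+ n.+1) = E / 4 ^+ n.
    by rewrite exprS; field; rewrite expf_neq0.
  rewrite -E4 in big.
  have [i [j [xi iw yj jh ebig]]] :=
    circulation_quarter _ _ _ _ _ _ cP cQ _ _ _ _ _ (half0 w n.+1 w0)
      (half0 h n.+1 h0) ax xb cy yd big.
  exists (i, j) => _; split => //=.
  split; split => //=.
  - exact: le_trans xi.
  - exact: le_trans xb.
  - exact: le_trans yj.
  - exact: le_trans yd.
pose s := fix s n := if n is m.+1 then nxt (m, s m) else (a, c).
have sbad n : bad n (s n).
  elim: n => [|n IH]; last by have [] := nxtP (n, s n) IH.
  rewrite /bad /= !expr0 !divr1 wE hE ![_ + (_ - _)]addrC !subrK EE.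
  by do 2 split.
have [X XP] : exists X, forall n, (s n).1 <= X <= (s n).1 + w / 2 ^+ n.
  apply: (@nested_segments (fun n => (s n).1) (fun n => w / 2 ^+ n)) => n.
    exact: half0.
  by have [] := nxtP (n, s n) (sbad n).
have [Y YP] : exists Y, forall n, (s n).2 <= Y <= (s n).2 + h / 2 ^+ n.
  apply: (@nested_segments (fun n => (s n).2) (fun n => h / 2 ^+ n)) => n.
    exact: half0.
  by have [] := nxtP (n, s n) (sbad n).
have XI : a <= X <= b.
  by have := XP 0%N; rewrite /= expr0 divr1 wE [_ + (_ - _)]addrC subrK.
have YI : c <= Y <= d.
  by have := YP 0%N; rewrite /= expr0 divr1 hE [_ + (_ - _)]addrC subrK.
have [A [B [C [gP gQ]]]] := diffPQ X Y XI YI.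
have wh1 : 0 < (w + h) ^+ 2 + 1 by rewrite ltr_wpDl ?sqr_ge0.
(* The n-th rectangle will have circulation at most 2 e (w + h)^2 / 4^n; this
   choice of e makes it less than E / 4^n, even when w + h = 0. *)
have [e eE] : exists e, e = E / (4 * ((w + h) ^+ 2 + 1)) by eexists.
have e0 : 0 < e by rewrite eE divr_gt0// mulr_gt0.
have [r1 r10 {}gP] := gP e e0; have [r2 r20 {}gQ] := gQ e e0.
have [n nP] : exists n, (w + h) / 2 ^+ n < Num.min r1 r2.
  have r0 : 0 < Num.min r1 r2 by rewrite lt_min r10.
  have [n n1] : exists n, (w + h) / Num.min r1 r2 < n%:R.
    exists (Num.bound ((w + h) / Num.min r1 r2)).
    exact: (archi_boundP (divr_ge0 (addr_ge0 w0 h0) (ltW r0))).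
  exists n; have n2 : n%:R < 2 ^+ n :> R by rewrite -natrX ltr_nat ltn_expl.
  rewrite ltr_pdivrMr ?exprn_gt0//.
  by move: (lt_trans n1 n2); rewrite ltr_pdivrMr// mulrC.
move: nP; rewrite lt_min => /andP[n1 n2].
have := sbad n; have := XP n; have := YP n; move: (s n) => [x y].
rewrite /bad/= => yY xX [[ax xb] [cy yd big]].
have wn0 := half0 w n w0; have hn0 := half0 h n h0.
have whn : (w + h) / 2 ^+ n = w / 2 ^+ n + h / 2 ^+ n by rewrite mulrDl.
have near1 (t u T v : R) : t <= T <= t + v -> t <= u <= t + v -> `|u - T| <= v.
  move=> /andP[t1 t2] /andP[t3 t4]; rewrite ler_norml.
  by clear -t1 t2 t3 t4; apply/andP; split; lra.
have local (S : R -> R -> R) (A' B' r : R) :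
  (forall x' y', `|x' - X| < r -> `|y' - Y| < r ->
    `|S x' y' - S X Y - (A' * (x' - X) + B' * (y' - Y))|
      <= e * (`|x' - X| + `|y' - Y|)) -> (w + h) / 2 ^+ n < r ->
  forall x' y', x <= x' <= x + w / 2 ^+ n -> y <= y' <= y + h / 2 ^+ n ->
    `|S x' y' - S X Y - (A' * (x' - X) + B' * (y' - Y))| <= e * ((w + h) / 2 ^+ n).
  rewrite whn => gS nr x' y' xI yI.
  have dx := near1 _ _ _ _ xX xI; have dy := near1 _ _ _ _ yY yI.
  apply: le_trans (gS x' y' _ _) _.
  - by rewrite (le_lt_trans dx)// (le_lt_trans _ nr)// lerDl.
  - by rewrite (le_lt_trans dy)// (le_lt_trans _ nr)// lerDr.
  - by rewrite ler_wpM2l ?(ltW e0)// lerD.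
have {}gP := local P A B r1 gP n1; have {}gQ := local Q B C r2 gQ n2.
have up := circulation_small _ _ _ _ _ _ cP cQ _ _ _ _ _ _ _ _ _ _
  wn0 hn0 ax xb cy yd gP gQ.
have := le_trans big up; apply/negP; rewrite -ltNge.
have -> : 2 * (e * ((w + h) / 2 ^+ n)) * (w / 2 ^+ n + h / 2 ^+ n) =
    2 * e * (w + h) ^+ 2 / 4 ^+ n.
  rewrite (_ : 4 = 2 * 2); last by ring.
  by rewrite exprMn; field; rewrite expf_neq0.
rewrite ltr_pM2r ?invr_gt0 ?exprn_gt0//.
have -> : 2 * e * (w + h) ^+ 2 = E * ((w + h) ^+ 2 / (2 * ((w + h) ^+ 2 + 1))).
  by rewrite eE; field; rewrite gt_eqF.
rewrite -[ltRHS]mulr1 ltr_pM2l// ltr_pdivrMr ?mulr_gt0// mul1r.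
by have := sqr_ge0 (w + h); clear; move: (_ ^+ 2) => t; lra.
Qed.

End goursat.

(** * Cauchy-Riemann equations *)

Section complex_derivative.
Context {R : realType}.

Lemma normc_le_normD (u v : R) : `|u +i* v| <= (`|u| + `|v|)%:C.
Proof.
rewrite normc_def lecR /= -[leRHS]ger0_norm ?addr_ge0// -sqrtr_sqr ler_wsqrtr//.
by rewrite sqrrD !real_normK ?num_real//; have := mulr_ge0 (normr_ge0 u) (normr_ge0 v); lra.
Qed.

Lemma derivable_cauchy_riemann (f : R[i] -> R[i]) x y :
  derivable (f : (R[i])^o -> (R[i])^o) (x +i* y) 1 ->
  exists A B,
    has_gradient (fun x y => complex.Re (f (x +i* y))) x y A (- B) /\
    has_gradient (fun x y => complex.Im (f (x +i* y))) x y B A.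
Proof.
move=> /cvg_ex[l /= fl]; set z := x +i* y in fl.
have key : forall e : R, 0 < e -> exists2 r : R, 0 < r & forall u v : R,
    `|u| < r -> `|v| < r ->
    `|f (z + (u +i* v)) - f z - l * (u +i* v)| <= (e * (`|u| + `|v|))%:C.
  move=> e e0; have eC : 0 < e%:C by rewrite ltcR.
  move/cvgrPdist_le : fl => /(_ _ eC).
  rewrite /dnbhs /within /= => /nbhs_ballP[[r ri] /= r0 H].
  move: r0; rewrite ltcE/= => /andP[/eqP ri0 r0]; subst ri.
  exists (r / 2); first by rewrite divr_gt0.
  move=> u v ur vr; set h := u +i* v.
  have [h0|h0] := eqVneq h 0.
    rewrite h0 addr0 subrr mulr0 subrr normr0 lecR mulr_ge0 ?addr_ge0//; exact: ltW.
  have hr : ball (0 : (R[i])^o) (r +i* 0) h.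
    rewrite -ball_normE /ball_ /= sub0r normrN (le_lt_trans (normc_le_normD u v))//.
    by rewrite complexr0 ltcR; lra.
  have := H h hr h0.
  rewrite [h *: 1]mulr1 (addrC h) [h^-1 *: _]mulrC => Hh.
  have -> : f (z + h) - f z - l * h = - (l - (f (z + h) - f z) / h) * h.
    by rewrite mulNr mulrBl divfK// opprB.
  rewrite normrM normrN rmorphM/=.
  by apply: ler_pM => //; exact: normc_le_normD.
case: l fl key => A B fl key.
have ReC (w : R[i]) : `|complex.Re w|%:C <= `|w| := normc_ge_Re w.
have ImC (w : R[i]) : `|complex.Im w|%:C <= `|w|.
  by rewrite normc_def lecR -sqrtr_sqr ler_wsqrtr// lerDr sqr_ge0.
have zh x' y' : z + ((x' - x) +i* (y' - y)) = x' +i* y'.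
  by rewrite /z; congr (_ +i* _); rewrite addrC subrK.
exists A, B; split=> e /key[r r0 H]; exists r => // x' y' xr yr.
- have := H _ _ xr yr; rewrite zh => /(le_trans (ReC _)); rewrite lecR.
  congr (`|_| <= _).
  case: (f _) => a b; case: (f z) => c d /=; ring.
- have := H _ _ xr yr; rewrite zh => /(le_trans (ImC _)); rewrite lecR.
  congr (`|_| <= _).
  case: (f _) => a b; case: (f z) => c d /=; ring.
Qed.

End complex_derivative.

(** * Differentiating weighted integrals of a closed form *)

Section by_parts.
Context {R : realType}.
Implicit Types (g psi dpsi : R -> R) (a b : R).

Lemma is_derive_segint a g t : continuous g -> a < t ->
  is_derive t 1 (fun t => segint a t g) (g t).
Proof.
move=> cg at_.
have ig : lebesgue_measure.-integrable `[a, t + 1] (EFin \o g).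
  by apply: segment_integrable; exact: continuous_subspaceT.
have [|d1 d2] := continuous_FTC1_closed _ ig at_ (cg t); first by rewrite ltrDl.
by apply: DeriveDef; [exact: d1|rewrite -derive1E; exact: d2].
Qed.

Lemma is_derive_continuous (g dg : R -> R) : (forall x : R, is_derive x 1 g (dg x)) ->
  continuous g.
Proof.
by move=> h x; apply/differentiable_continuous/derivable1_diffP; have [] := h x.
Qed.

(** The primitive of g starts at a - 1 rather than a so that it is derivable on
    the whole of [a, b]; the choice is immaterial as psi vanishes at both ends. *)
Lemma segint_by_parts a b psi dpsi g : a < b ->
  (forall x : R, is_derive x 1 psi (dpsi x)) -> continuous dpsi -> continuous g ->
  psi a = 0 -> psi b = 0 ->
  segint a b (fun x => psi x * g x) =
  - segint a b (fun x => dpsi x * segint (a - 1) x g).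
Proof.
move=> ab dpsiP cdpsi cg pa pb.
have cpsi := is_derive_continuous _ _ dpsiP.
have dG x : a <= x -> is_derive x 1 (fun t => segint (a - 1) t g) (g x).
  by move=> ax; apply: is_derive_segint => //; rewrite (lt_le_trans _ ax)// ltrBlDr ltrDl.
have cG x : a <= x -> {for x, continuous (fun t => segint (a - 1) t g)}.
  by move=> ax; apply/differentiable_continuous/derivable1_diffP; have [] := dG x ax.
rewrite /segint (@Rintegration_by_parts R psi (fun t => segint (a - 1) t g) dpsi g)//.
- by rewrite pa pb !mul0r subrr sub0r.
- exact: continuous_subspaceT.
- split=> [x _||]; first by have [] := dpsiP x.
    by apply: cvg_at_right_filter; exact: cpsi.
  by apply: cvg_at_left_filter; exact: cpsi.
- by move=> x _; rewrite derive1E; have [] := dpsiP x.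
- exact: continuous_subspaceT.
- split=> [x||].
  + by rewrite in_itv/= => /andP[ax _]; have [] := dG x (ltW ax).
  + by apply: cvg_at_right_filter; exact: cG.
  + by apply: cvg_at_left_filter; exact: cG (ltW ab).
- by move=> x; rewrite in_itv/= => /andP[ax _]; rewrite derive1E; have [] := dG x (ltW ax).
Qed.

Lemma segint_derive_eq0 a b psi dpsi : a < b ->
  (forall x : R, is_derive x 1 psi (dpsi x)) -> continuous dpsi ->
  psi a = 0 -> psi b = 0 -> segint a b dpsi = 0.
Proof.
move=> ab dpsiP cdpsi pa pb.
have cpsi := is_derive_continuous _ _ dpsiP.
rewrite /segint /Rintegral (@continuous_FTC2 R dpsi psi)// ?pa ?pb -?EFinB ?subrr//.
- exact: continuous_subspaceT.
- split=> [x _||]; first by have [] := dpsiP x.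
    by apply: cvg_at_right_filter; exact: cpsi.
  by apply: cvg_at_left_filter; exact: cpsi.
- by move=> x _; rewrite derive1E; have [] := dpsiP x.
Qed.

End by_parts.

Lemma is_derive_of_estimate {R : realType} (U : R -> R) (y L : R) :
  (forall e : R, 0 < e -> exists2 r : R, 0 < r & forall h, `|h| < r ->
    `|U (y + h) - U y - L * h| <= e * `|h|) ->
  is_derive y 1 U L.
Proof.
move=> H.
suff cv : h^-1 *: (U (h *: 1 + y) - U y) @[h --> 0^'] --> L.
  by apply: DeriveDef; [apply/cvg_ex; exists L|exact: cvg_lim].
apply/cvgrPdist_le => e /H[r r0 {}H].
apply/nbhs_ballP; exists r => //= h; rewrite /ball/= sub0r normrN => hr h0.
rewrite [h *: 1]mulr1 (addrC h) [_ *: _]mulrC distrC.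
have -> : (U (y + h) - U y) / h - L = (U (y + h) - U y - L * h) / h.
  by rewrite [RHS]mulrBl mulfK.
by rewrite normrM normfV ler_pdivrMr ?normr_gt0//; exact: H.
Qed.

Section closed_form.
Context {R : realType}.
Variables (P Q : R -> R -> R).
Hypothesis closedPQ : forall x y : R, 0 < y ->
  exists A B C, has_gradient P x y A B /\ has_gradient Q x y B C.

Let cP y : 0 < y -> continuous (fun x => P x y).
Proof.
move=> y0 x; have [A [B [C [gP _]]]] := closedPQ x y y0.
exact: has_gradient_continuous1 gP.
Qed.

Let cQ y : 0 < y -> continuous (fun x => Q x y).
Proof.
move=> y0 x; have [A [B [C [_ gQ]]]] := closedPQ x y y0.
exact: has_gradient_continuous1 gQ.
Qed.

Let cQ2 x y : 0 < y -> {for y, continuous (fun y => Q x y)}.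
Proof.
move=> y0; have [A [B [C [_ gQ]]]] := closedPQ x y y0.
exact: has_gradient_continuous2 gQ.
Qed.

(** Joint continuity and compactness of the segment make the continuity in y
    uniform in t. *)
Lemma uniformly_close_on_segment a b y e : 0 < y -> 0 < e ->
  exists2 r : R, 0 < r & forall s, `|s - y| < r ->
    0 < s /\ forall t, a <= t <= b -> `|Q t s - Q t y| <= e.
Proof.
move=> y0 e0.
have e20 : 0 < e / 2 by rewrite divr_gt0.
have /compact_near_coveringP cover := @segment_compact R a b.
have : \forall s \near y, `[a, b] `<=` (fun t => `|Q t s - Q t y| <= e).
  apply: (cover _ (nbhs y) (fun s t => `|Q t s - Q t y| <= e)) => t _; have [A [B [C [_ /has_gradient_continuous gQ]]]] := closedPQ t y y0.
  move/cvgrPdist_le : gQ => /(_ _ e20)[[U V] /= [tU yV] H1].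
  move/cvgrPdist_le : (cQ y y0 t) => /(_ _ e20) H2.
  exists ([set t' | U t' /\ `|Q t y - Q t' y| <= e / 2], V) => /=.
    by split=> //; apply: filterI.
  move=> [t' s] /= [[Ut h2] Vs]; have /= h1 := H1 (t', s) (conj Ut Vs).
  move: h1 h2; rewrite !ler_norml => /andP[? ?] /andP[? ?].
  by apply/andP; split; lra.
move=> /nbhs_ballP[r /= r0 H]; exists (Num.min r y); first by rewrite lt_min r0.
move=> s; rewrite lt_min => /andP[sr sy]; split.
  by move: sy; rewrite ltr_norml => /andP[? ?]; lra.
by move=> t tI; apply: (H s) => //=; rewrite /ball/= distrC.
Qed.

(** Formally, P_y = Q_x and an integration by parts. As P_y need not be
    integrable, the integration by parts comes first: it replaces P(., y) by its
    primitive, whose increments in y are integrals of Q by Goursat's theorem. *)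
Lemma is_derive_weighted_segint a b (psi dpsi : R -> R) (y : R) : a < b ->
  (forall x : R, is_derive x 1 psi (dpsi x)) -> continuous dpsi ->
  psi a = 0 -> psi b = 0 -> 0 < y ->
  is_derive y 1 (fun y => segint a b (fun x => psi x * P x y))
    (- segint a b (fun x => dpsi x * Q x y)).
Proof.
move=> ab dpsiP cdpsi pa pb y0.
set U := fun y => _; set V := segint a b _.
have [M M0 dpsiM] : exists2 M, 0 < M & forall x, a <= x <= b -> `|dpsi x| <= M.
  have := continuous_compact (continuous_subspaceT cdpsi) (@segment_compact R a b).
  move=> /compact_bounded[M0 [_ H]]; exists (`|M0| + 1); first by rewrite ltr_wpDl.
  move=> x xI; apply: (H (`|M0| + 1)); first by rewrite (le_lt_trans (ler_norm _))// ltrDl.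
  by exists x => //=; rewrite in_itv.
have prim y1 y2 t : 0 < y1 -> y1 <= y2 -> a <= t ->
    segint (a - 1) t (fun x => P x y2) - segint (a - 1) t (fun x => P x y1) =
    segint y1 y2 (fun s => Q t s - Q (a - 1) s).
  move=> y10 y12 at_; apply/eqP; rewrite -subr_eq0 -segintB; last 2 first.
  - by apply: continuous_subspaceT; apply: cP; exact: lt_le_trans y12.
  - by apply: continuous_subspaceT; exact: cP.
  apply/eqP; apply: circulation_eq0 => //.
    by rewrite (le_trans _ at_)// lerBlDr lerDl.
  by move=> x s _ /andP[ys _]; apply: closedPQ; exact: lt_le_trans ys.
have UE s : 0 < s -> U s = - segint a b (fun x => dpsi x * segint (a - 1) x (fun x => P x s)).
  by move=> s0; apply: (segint_by_parts _ _ psi) => //; exact: cP.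
have cprim s : 0 < s ->
    {within `[a, b], continuous (fun x => segint (a - 1) x (fun x => P x s))}.
  move=> s0; apply/continuous_in_subspaceT => x; rewrite inE/= in_itv/= => /andP[ax _].
  apply/differentiable_continuous/derivable1_diffP.
  have [|//] := @is_derive_segint _ (a - 1) (fun x => P x s) x (cP s s0).
  by rewrite (lt_le_trans _ ax)// ltrBlDr ltrDl.
have cmul (g : R -> R) : {within `[a, b], continuous g} ->
    {within `[a, b], continuous (fun x => dpsi x * g x)}.
  by move=> cg; move=> x; apply: cvgM; [exact: continuous_subspaceT|exact: cg].
(* Subtracting Q(a - 1, y), which changes nothing since dpsi has integral 0,
   gives the integrand that Goursat's theorem produces below. *)
have VE : V = segint a b (fun x => dpsi x * (Q x y - Q (a - 1) y)).
  under eq_segint do rewrite mulrBr [_ * Q (a - 1) y]mulrC.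
  rewrite segintB; last 2 first.
  - by apply: cmul; apply: continuous_subspaceT; exact: cQ.
  - by apply: continuous_subspaceT => x; apply: cvgM; [exact: cvg_cst|exact: cdpsi].
  rewrite segintZ; last exact: continuous_subspaceT.
  by rewrite (segint_derive_eq0 _ _ psi dpsi)// mulr0 subr0.
have est e : 0 < e -> exists2 r : R, 0 < r & forall y1 y2,
    y - r < y1 -> y1 <= y2 -> y2 < y + r ->
    `|U y2 - U y1 + V * (y2 - y1)| <= e * (y2 - y1).
  move=> e0; pose e' := e / (2 * M * (b - a)).
  have ba : 0 < b - a by rewrite subr_gt0.
  have e'0 : 0 < e' by rewrite divr_gt0// !mulr_gt0.
  have [r r0 tube] := uniformly_close_on_segment (a - 1) b y e' y0 e'0.
  exists r => // y1 y2 ry1 y12 y2r.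
  have ball s : y1 <= s <= y2 -> `|s - y| < r.
    by move=> /andP[? ?]; rewrite ltr_norml; apply/andP; split; lra.
  have y1_gt0 : 0 < y1 by have [] := tube _ (ball y1 _); rewrite ?lexx.
  have y2_gt0 : 0 < y2 by exact: lt_le_trans y12.
  have d t : a <= t <= b -> `|segint (a - 1) t (fun x => P x y2) -
      segint (a - 1) t (fun x => P x y1) - (Q t y - Q (a - 1) y) * (y2 - y1)|
      <= (e' + e') * (y2 - y1).
    move=> /andP[at_ tb]; rewrite prim//; apply: segint_near_cst => //.
      apply: within_continuousB; apply/continuous_in_subspaceT => s;
        rewrite inE/= in_itv/= => /andP[s1 _]; apply: cQ2; exact: lt_le_trans s1.
    move=> s sI; have [_ tub] := tube s (ball s sI).
    have a1b : a - 1 <= a - 1 <= b.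
      by rewrite lexx/= (le_trans _ (ltW ab))// lerBlDr lerDl.
    have tI : a - 1 <= t <= b by rewrite tb andbT (le_trans _ at_)// lerBlDr lerDl.
    move: (tub _ a1b) (tub _ tI); rewrite !ler_norml => /andP[p1 p2] /andP[q1 q2].
    by apply/andP; split; lra.
  have -> : U y2 - U y1 + V * (y2 - y1) =
      - segint a b (fun x => dpsi x * (segint (a - 1) x (fun x => P x y2) -
      segint (a - 1) x (fun x => P x y1) - (Q x y - Q (a - 1) y) * (y2 - y1))).
    have -> : segint a b (fun x => dpsi x * (segint (a - 1) x (fun x => P x y2) -
      segint (a - 1) x (fun x => P x y1) - (Q x y - Q (a - 1) y) * (y2 - y1))) =
      segint a b (fun x => dpsi x * segint (a - 1) x (fun x => P x y2) -
        dpsi x * segint (a - 1) x (fun x => P x y1) -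
        (y2 - y1) * (dpsi x * (Q x y - Q (a - 1) y))).
      by apply: eq_segint => x _; ring.
    have cQy : {within `[a, b], continuous (fun x => dpsi x * (Q x y - Q (a - 1) y))}.
      by apply: cmul; apply: within_continuousB; apply: continuous_subspaceT;
        [exact: cQ|move=> ?; exact: cvg_cst].
    rewrite segintB; last 2 first.
    - by apply: within_continuousB; apply: cmul; exact: cprim.
    - by move=> x; apply: cvgM; [exact: cvg_cst|exact: cQy].
    rewrite segintB; last 2 first.
    - by apply: cmul; exact: cprim.
    - by apply: cmul; exact: cprim.
    by rewrite segintZ// -VE !UE//; ring.
  rewrite normrN.
  have := @segint_near_cst _ a b (fun x => dpsi x * (segint (a - 1) x (fun x => P x y2) -
      segint (a - 1) x (fun x => P x y1) - (Q x y - Q (a - 1) y) * (y2 - y1)))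
      0 (M * ((e' + e') * (y2 - y1))) (ltW ab).
  rewrite mul0r subr0.
  have -> : M * ((e' + e') * (y2 - y1)) * (b - a) = e * (y2 - y1).
    by rewrite /e'; field; rewrite !gt_eqF.
  apply.
    apply: cmul; apply: within_continuousB.
      by apply: within_continuousB; exact: cprim.
    apply: continuous_subspaceT => x; apply: cvgM; last exact: cvg_cst.
    by apply: cvgB; [exact: cQ|exact: cvg_cst].
  move=> x xI; rewrite subr0 normrM; apply: ler_pM => //; first exact: dpsiM.
  exact: d.
apply: is_derive_of_estimate => e e0; have [r r0 H] := est e e0.
exists r => // h; rewrite ltr_norml => /andP[h1 h2].
have [h0|h0] := leP 0 h.
  have := H y (y + h); rewrite (addrC y h) addrK mulNr opprK (ger0_norm h0).
  by apply; lra.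
have := H (y + h) y; rewrite (ltr0_norm h0) mulNr opprK.
have -> : y - (y + h) = - h by ring.
rewrite -normrN; have -> : - (U y - U (y + h) + V * - h) = U (y + h) - U y + V * h by ring.
by apply; lra.
Qed.

End closed_form.

(** * Two differential inequalities on the half-line *)

Section differential_inequalities.
Context {R : realType}.
Implicit Types (g dg : R -> R).

Lemma mvt_half_line g dg (y z : R) :
  (forall t : R, 0 < t -> is_derive t 1 g (dg t)) -> 0 < y -> y < z ->
  exists2 c, y < c < z & g z - g y = dg c * (z - y).
Proof.
move=> dgP y0 yz.
have [||c] := @MVT R g dg y z yz.
- by move=> t; rewrite in_itv/= => /andP[yt _]; apply: dgP; exact: lt_trans yt.
- apply/continuous_in_subspaceT => t; rewrite inE/= in_itv/= => /andP[yt _].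
  apply/differentiable_continuous/derivable1_diffP.
  by have [] := dgP t (lt_le_trans y0 yt).
by rewrite in_itv/= => cI e; exists c.
Qed.

(** The factorisation U'' - k^2 U = (d/dy - k)(U' + k U) shows that
    exp(- k y)(U' + k U) is nonincreasing. If it were negative at one point,
    exp(k y) U would decrease at least linearly from there on and become
    negative, so U' + k U >= 0, that is, exp(k y) U is nondecreasing. *)
Lemma exp_growth (U U1 U2 : R -> R) (k y z : R) :
  (forall t : R, 0 < t -> is_derive t 1 U (U1 t)) ->
  (forall t : R, 0 < t -> is_derive t 1 U1 (U2 t)) ->
  (forall t : R, 0 < t -> 0 <= U t) ->
  (forall t : R, 0 < t -> U2 t <= k ^+ 2 * U t) ->
  0 < k -> 0 < y -> y < z ->
  expR (k * y) * U y <= expR (k * z) * U z.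
Proof.
move=> dU dU1 U0 U2le k0 y0 yz.
have dexp (c t : R) : is_derive t 1 (fun t => expR (c * t)) (c * expR (c * t)).
  have d1 : is_derive t 1 (fun t : R => c * t) c.
    have := @is_deriveZ _ _ _ id c t 1 1 (is_derive_id _ _).
    by rewrite /GRing.scale/= mulr1.
  have d2 := @is_derive1_comp R expR (fun t : R => c * t) t _ c (is_derive_expR _) d1.
  by rewrite mulrC; exact: d2.
pose Z (t : R) := expR (- k * t) * (U1 t + k * U t).
have dZ (t : R) : 0 < t -> is_derive t 1 Z (expR (- k * t) * (U2 t - k ^+ 2 * U t)).
  move=> t0; have ? := dU t t0; have ? := dU1 t t0; have ? := dexp (- k) t.
  rewrite /Z; apply: is_derive_eq; rewrite /GRing.scale/=; ring.
pose N (t : R) := expR (k * t) * U t.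
have dN (t : R) : 0 < t -> is_derive t 1 N (expR (k * t) * (U1 t + k * U t)).
  move=> t0; have ? := dU t t0; have ? := dexp k t.
  rewrite /N; apply: is_derive_eq; rewrite /GRing.scale/=; ring.
have Zdecr s t : 0 < s -> s < t -> Z t <= Z s.
  move=> s0 st; have [c /andP[sc _] e] := mvt_half_line _ _ _ _ dZ s0 st.
  rewrite -subr_le0 e mulr_le0_ge0 ?subr_ge0 ?(ltW st)// mulr_ge0_le0 ?expR_ge0//.
  by rewrite subr_le0 U2le// (lt_trans s0).
have pos t : 0 < t -> 0 <= U1 t + k * U t.
  move=> t0; rewrite leNgt; apply/negP => neg.
  have Zt : Z t < 0 by rewrite pmulr_rlt0 ?expR_gt0.
  (* N has slope at most Z t < 0 after t, so it is negative at w. *)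
  pose w := t + N t / (- Z t) + 1.
  have Nt : 0 <= N t by rewrite mulr_ge0 ?expR_ge0 ?U0.
  have Nq : 0 <= N t / (- Z t) by rewrite divr_ge0// oppr_ge0 ltW.
  have tw : t < w by rewrite /w; lra.
  have [c /andP[tc _] e] := mvt_half_line _ _ _ _ dN t0 tw.
  have c0 : 0 < c by exact: lt_trans tc.
  have slope : expR (k * c) * (U1 c + k * U c) <= Z t.
    have -> : expR (k * c) * (U1 c + k * U c) = expR (k * c) * expR (k * c) * Z c.
      have : expR (k * c) * expR (- k * c) = 1 by rewrite mulNr expRxMexpNx_1.
      rewrite /Z => h; rewrite -[LHS]mul1r -h; ring.
    apply: le_trans (Zdecr _ _ t0 tc).
    have Zc : Z c <= 0 by rewrite (le_trans (Zdecr _ _ t0 tc))// ltW.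
    rewrite -[leRHS]mul1r ler_wnM2r// -[leLHS]mulr1.
    by apply: ler_pM => //; rewrite -expR0 ler_expR mulr_ge0// ltW.
  have : N w < 0.
    have -> : N w = N t + expR (k * c) * (U1 c + k * U c) * (w - t) by rewrite -e; ring.
    apply: (@le_lt_trans _ _ (N t + Z t * (w - t))).
      by rewrite lerD2l ler_wpM2r// subr_ge0 ltW.
    have -> : N t + Z t * (w - t) = Z t by rewrite /w; field; rewrite lt_eqF.
    by [].
  by apply/negP; rewrite -leNgt mulr_ge0 ?expR_ge0// U0// (lt_trans t0).
have [c /andP[yc _] e] := mvt_half_line _ _ _ _ dN y0 yz.
rewrite -subr_ge0 [_ - _]e mulr_ge0 ?subr_ge0 ?(ltW yz)//.
by rewrite mulr_ge0 ?expR_ge0// pos// (lt_trans y0).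
Qed.

(** The function T(t) = U(t) + s t^2 / 2 is convex and nonnegative, so its slope
    between y and z is at most its slope between z and h, hence at most
    T(h) / (h - z). *)
Lemma almost_convex_chord (U U1 U2 : R -> R) (s y z h : R) :
  (forall t : R, 0 < t -> is_derive t 1 U (U1 t)) ->
  (forall t : R, 0 < t -> is_derive t 1 U1 (U2 t)) ->
  (forall t : R, 0 < t -> 0 <= U t) -> 0 <= s ->
  (forall t : R, 0 < t -> t < h -> - s <= U2 t) ->
  0 < y -> y < z -> z < h ->
  U z <= U y + s * y ^+ 2 / 2 + z * (U h + s * h ^+ 2 / 2) / (h - z).
Proof.
move=> dU dU1 U0 s0 U2ge y0 yz zh.
pose T (t : R) := U t + s * t ^+ 2 / 2.
have dsq (c t : R) : is_derive t 1 (fun t : R => c * t ^+ 2 / 2) (c * t).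
  have e : (fun t : R => c * t ^+ 2 / 2) = (fun t : R => (c / 2) *: (t ^+ 2)).
    by apply/funext => u; rewrite /GRing.scale/=; ring.
  by rewrite e; apply: is_derive_eq; rewrite /GRing.scale/=; field.
have dlin (c t : R) : is_derive t 1 (fun t : R => c * t) c.
  have := @is_deriveZ _ _ _ id c t 1 1 (is_derive_id _ _).
  by rewrite /GRing.scale/= mulr1.
have dT (t : R) : 0 < t -> is_derive t 1 T (U1 t + s * t).
  by move=> t0; have ? := dU t t0; have ? := dsq s t; exact: is_deriveD.
have dT1 (t : R) : 0 < t -> is_derive t 1 (fun t => U1 t + s * t) (U2 t + s).
  by move=> t0; have ? := dU1 t t0; have ? := dlin s t; exact: is_deriveD.
have z0 : 0 < z by exact: lt_trans yz.
have [c1 /andP[yc1 c1z] e1] := mvt_half_line _ _ _ _ dT y0 yz.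
have [c2 /andP[zc2 c2h] e2] := mvt_half_line _ _ _ _ dT z0 zh.
have c10 : 0 < c1 by exact: lt_trans yc1.
have [c3 /andP[c13 c32] e3] := mvt_half_line _ _ _ _ dT1 c10 (lt_trans c1z zc2).
have hz : 0 < h - z by rewrite subr_gt0.
have T0 t : 0 < t -> 0 <= T t.
  by move=> t0; rewrite addr_ge0 ?U0// divr_ge0// mulr_ge0// sqr_ge0.
have sl : U1 c1 + s * c1 <= U1 c2 + s * c2.
  rewrite -subr_ge0 e3 mulr_ge0 ?subr_ge0 ?(ltW (lt_trans c1z zc2))//.
  by rewrite -lerBlDr sub0r U2ge ?(lt_trans c10)// (lt_trans c32).
have sl2 : U1 c2 + s * c2 <= T h / (h - z).
  by rewrite ler_pdivlMr// -e2 gerBl T0.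
have Th : 0 <= T h / (h - z) by rewrite divr_ge0 ?T0 ?(ltW hz)// (lt_trans z0).
have : T z <= T y + z * (T h / (h - z)).
  rewrite addrC -lerBlDr e1 mulrC.
  apply: (@le_trans _ _ ((z - y) * (T h / (h - z)))).
    by rewrite ler_wpM2l ?subr_ge0 ?(ltW yz)// (le_trans sl).
  by rewrite ler_wpM2r// gerBl ltW.
rewrite /T mulrA => h1.
by apply: le_trans h1; rewrite lerDl divr_ge0// mulr_ge0// sqr_ge0.
Qed.

End differential_inequalities.

(** * The bump function *)

Section bump.
Context {R : realType}.
Implicit Types tau a x : R.

(** It serves as a bump on [tau - a, tau + a] only. There it vanishes at both ends
    together with its derivative, which removes the boundary terms of two
    integrations by parts. *)
Definition smooth_bump tau a x : R := (1 - a ^- 2 * (x - tau) ^+ 2) ^+ 3.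

Definition dsmooth_bump tau a x : R :=
  - 6 * a ^- 2 * (x - tau) * (1 - a ^- 2 * (x - tau) ^+ 2) ^+ 2.

Definition ddsmooth_bump tau a x : R :=
  6 * a ^- 2 * (1 - a ^- 2 * (x - tau) ^+ 2) * (5 * (a ^- 2 * (x - tau) ^+ 2) - 1).

Lemma is_derive_smooth_bump tau a x : is_derive x 1 (smooth_bump tau a) (dsmooth_bump tau a x).
Proof.
rewrite /smooth_bump /dsmooth_bump.
have -> : (fun x => (1 - a ^- 2 * (x - tau) ^+ 2) ^+ 3) =
  (fun x : R => (1 - a ^- 2 *: (x - tau) ^+ 2) ^+ 3) by [].
by apply: is_derive_eq; rewrite /GRing.scale/=; ring.
Qed.

Lemma is_derive_dsmooth_bump tau a x : is_derive x 1 (dsmooth_bump tau a) (ddsmooth_bump tau a x).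
Proof.
rewrite /ddsmooth_bump /dsmooth_bump.
have -> : (fun x => - 6 * a ^- 2 * (x - tau) * (1 - a ^- 2 * (x - tau) ^+ 2) ^+ 2) =
  (fun x : R => (- 6 * a ^- 2) *: ((x - tau) * (1 - a ^- 2 *: (x - tau) ^+ 2) ^+ 2)).
  by apply/funext => u; rewrite /GRing.scale/=; ring.
by apply: is_derive_eq; rewrite /GRing.scale/=; ring.
Qed.

Lemma continuous_ddsmooth_bump tau a : continuous (ddsmooth_bump tau a).
Proof.
have -> : ddsmooth_bump tau a = (fun x : R => (6 * a ^- 2) *:
    ((1 - a ^- 2 *: (x - tau) ^+ 2) * (5 *: (a ^- 2 *: (x - tau) ^+ 2) - 1))).
  by apply/funext => u; rewrite /ddsmooth_bump /GRing.scale/=; ring.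
move=> x; apply/differentiable_continuous/derivable1_diffP.
by apply: ex_derive.
Qed.

Lemma smooth_bump_edge tau a : 0 < a -> smooth_bump tau a (tau - a) = 0 /\ smooth_bump tau a (tau + a) = 0 /\
  dsmooth_bump tau a (tau - a) = 0 /\ dsmooth_bump tau a (tau + a) = 0.
Proof.
by move=> a0; rewrite /smooth_bump /dsmooth_bump; do ! split; field; rewrite gt_eqF.
Qed.

Lemma bump_variable01 tau a x : 0 < a -> tau - a <= x <= tau + a ->
  0 <= a ^- 2 * (x - tau) ^+ 2 <= 1.
Proof.
move=> a0 /andP[x1 x2]; apply/andP; split.
  by rewrite mulr_ge0 ?sqr_ge0// invr_ge0 sqr_ge0.
rewrite ler_pdivrMl ?exprn_gt0// mulr1 -[leRHS]real_normK ?num_real//.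
rewrite -[leLHS]real_normK ?num_real// ler_sqr ?nnegrE// (gtr0_norm a0).
by rewrite ler_norml; apply/andP; split; lra.
Qed.

Lemma smooth_bump01 tau a x : 0 < a -> tau - a <= x <= tau + a -> 0 <= smooth_bump tau a x <= 1.
Proof.
move=> a0 /(bump_variable01 _ _ _ a0); rewrite /smooth_bump; move: (_ * _) => t /andP[t0 t1].
by rewrite exprn_ge0 ?exprn_ile1//; lra.
Qed.

Lemma smooth_bump_half_ge tau a x : 0 < a -> tau - a / 2 <= x <= tau + a / 2 ->
  27 / 64 <= smooth_bump tau a x.
Proof.
move=> a0 /andP[x1 x2].
have : (a / 2) ^- 2 * (x - tau) ^+ 2 <= 1.
  have a20 : 0 < a / 2 by rewrite divr_gt0.
  by have /andP[] := bump_variable01 tau _ x a20 (introT andP (conj x1 x2)).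
rewrite /smooth_bump; have -> : (a / 2) ^- 2 = 4 * a ^- 2 by field; rewrite gt_eqF.
rewrite -mulrA; move: (a ^- 2 * _) => t t1.
have -> : 27 / 64 = (3 / 4) ^+ 3 :> R by field.
by rewrite lerXn2r// ?nnegrE; lra.
Qed.

(** With t = ((x - tau)/a)^2 in [0, 1], this is the positivity of
    3 a^-2 (1 - t)(3 t^2 + 4 t + 1). *)
Lemma ddsmooth_bump_ge tau a x : 0 < a -> tau - a <= x <= tau + a ->
  - ddsmooth_bump tau a x <= (3 / a) ^+ 2 * smooth_bump tau a x.
Proof.
move=> a0 /(bump_variable01 _ _ _ a0); rewrite /ddsmooth_bump /smooth_bump.
move: (_ * (x - tau) ^+ 2) => t /andP[t0 t1].
have -> : (3 / a) ^+ 2 = 9 * a ^- 2 by field; rewrite gt_eqF.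
have : 0 < a ^- 2 by rewrite invr_gt0 exprn_gt0.
move: (a ^- 2) => c c0; rewrite -subr_ge0.
have -> : 9 * c * (1 - t) ^+ 3 - - (6 * c * (1 - t) * (5 * t - 1)) =
   3 * c * ((1 - t) * (t * 4 + 3 * t ^+ 2 + 1)) by ring.
by rewrite !mulr_ge0//; [lra|lra|rewrite !addr_ge0// mulr_ge0// sqr_ge0].
Qed.

Lemma ddsmooth_bump_le tau a x : 0 < a -> tau - a <= x <= tau + a ->
  ddsmooth_bump tau a x <= 6 * a ^- 2.
Proof.
move=> a0 /(bump_variable01 _ _ _ a0); rewrite /ddsmooth_bump.
move: (_ * (x - tau) ^+ 2) => t /andP[t0 t1].
have : 0 < a ^- 2 by rewrite invr_gt0 exprn_gt0.
move: (a ^- 2) => c c0; rewrite -subr_ge0.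
have -> : 6 * c - 6 * c * (1 - t) * (5 * t - 1) =
   6 * c * (5 * (t - 3 / 5) ^+ 2 + 1 / 5) by field.
by rewrite !mulr_ge0//; [lra|rewrite addr_ge0// mulr_ge0// sqr_ge0].
Qed.

End bump.

(** * Smoothed mass of the imaginary part at a given height *)

Section smoothed_mass.
Context {R : realType}.
Variables (f : R[i] -> R[i]) (tau : R).
Hypothesis f_analytic : analytic_on upper_half_plane f.
Hypothesis f_maps :
  forall z : R[i], upper_half_plane z -> closed_upper_half_plane (f z).

Definition imf (x y : R) : R := complex.Im (f (x +i* y)).

Let ref (x y : R) : R := complex.Re (f (x +i* y)).

Let cauchy_riemann (x y : R) : 0 < y -> exists A B,
  has_gradient ref x y A (- B) /\ has_gradient imf x y B A.
Proof. by move=> y0; apply: derivable_cauchy_riemann; exact: f_analytic. Qed.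

Lemma imf_ge0 x y : 0 < y -> 0 <= imf x y.
Proof. by move=> y0; exact: (f_maps (x +i* y)). Qed.

Lemma continuous_imf y : 0 < y -> continuous (fun x => imf x y).
Proof.
move=> y0 x; have [A [B [_ gI]]] := cauchy_riemann x y y0.
exact: has_gradient_continuous1 gI.
Qed.

Definition mass (a y : R) : R :=
  segint (tau - a) (tau + a) (fun x => smooth_bump tau a x * imf x y).

Definition dmass (a y : R) : R :=
  - segint (tau - a) (tau + a) (fun x => dsmooth_bump tau a x * ref x y).

Definition ddmass (a y : R) : R :=
  - segint (tau - a) (tau + a) (fun x => ddsmooth_bump tau a x * imf x y).

Let edge_lt a : 0 < a -> tau - a < tau + a.
Proof. by move=> a0; lra. Qed.

Lemma is_derive_mass (a y : R) : 0 < a -> 0 < y ->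
  is_derive y 1 (mass a) (dmass a y).
Proof.
move=> a0 y0; have [e1 [e2 _]] := smooth_bump_edge tau a a0.
apply: is_derive_weighted_segint => //.
- move=> x z z0; have [A [B [gR gI]]] := cauchy_riemann x z z0.
  by exists B, A, (- B).
- exact: edge_lt.
- exact: is_derive_smooth_bump.
- by apply: is_derive_continuous => x; exact: is_derive_dsmooth_bump.
Qed.

Lemma is_derive_dmass (a y : R) : 0 < a -> 0 < y ->
  is_derive y 1 (dmass a) (ddmass a y).
Proof.
move=> a0 y0; have [_ [_ [e1 e2]]] := smooth_bump_edge tau a a0.
have d : is_derive y 1 (fun y => segint (tau - a) (tau + a)
    (fun x => dsmooth_bump tau a x * ref x y))
    (- segint (tau - a) (tau + a) (fun x => ddsmooth_bump tau a x * - imf x y)).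
  apply: (is_derive_weighted_segint ref (fun x y => - imf x y)) => //.
  - move=> x z z0; have [A [B [gR gI]]] := cauchy_riemann x z z0.
    exists A, (- B), (- A); split => // e /gI[r r0 H]; exists r => // x' y' xr yr.
    have := H x' y' xr yr; rewrite -normrN.
    by congr (`|_| <= _); ring.
  - exact: edge_lt.
  - exact: is_derive_dsmooth_bump.
  - exact: continuous_ddsmooth_bump.
have -> : ddmass a y = - - segint (tau - a) (tau + a) (fun x => ddsmooth_bump tau a x * - imf x y).
  rewrite opprK /ddmass -mulN1r -segintZ.
    by apply: eq_segint => x _; ring.
  apply: continuous_subspaceT => x.
  by apply: cvgM; [exact: continuous_ddsmooth_bump|exact: continuous_imf].
exact: is_deriveN.
Qed.

Let bump_cont a : continuous (smooth_bump tau a).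
Proof. by apply: is_derive_continuous => x; exact: is_derive_smooth_bump. Qed.

Let bump_imf_cont a y : 0 < y ->
  {within `[tau - a, tau + a], continuous (fun x => smooth_bump tau a x * imf x y)}.
Proof.
move=> y0; apply: continuous_subspaceT => x.
by apply: cvgM; [exact: bump_cont|exact: continuous_imf].
Qed.

Let ddbump_imf_cont a y : 0 < y ->
  {within `[tau - a, tau + a], continuous (fun x => ddsmooth_bump tau a x * imf x y)}.
Proof.
move=> y0; apply: continuous_subspaceT => x.
by apply: cvgM; [exact: continuous_ddsmooth_bump|exact: continuous_imf].
Qed.

Let imf_cont a b y : 0 < y -> {within `[a, b], continuous (fun x => imf x y)}.
Proof. by move=> y0; apply: continuous_subspaceT; exact: continuous_imf. Qed.

Lemma mass_ge0 a y : 0 < a -> 0 < y -> 0 <= mass a y.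
Proof.
move=> a0 y0; apply: Rintegral_ge0 => x /=; rewrite in_itv/= => xI.
by rewrite mulr_ge0 ?imf_ge0//; have /andP[] := smooth_bump01 tau a x a0 xI.
Qed.

(** As Im f >= 0, the inequality - phi'' <= (3/a)^2 phi for the bump becomes
    U'' <= (3/a)^2 U for the smoothed mass. *)
Lemma mass_growth a y z : 0 < a -> 0 < y -> y < z ->
  mass a y <= expR (3 / a * z) * mass a z.
Proof.
move=> a0 y0 yz.
have k0 : 0 < 3 / a by rewrite divr_gt0.
apply: (@le_trans _ _ (expR (3 / a * y) * mass a y)).
  rewrite -[leLHS]mul1r ler_wpM2r ?mass_ge0//.
  have : 0 <= 3 / a * y by rewrite mulr_ge0// ltW.
  by move: (3 / a * y) => t t0; rewrite -expR0 ler_expR.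
apply: (exp_growth _ (dmass a) (ddmass a)) => // t t0.
- exact: is_derive_mass.
- exact: is_derive_dmass.
- exact: mass_ge0.
rewrite /ddmass /mass -segintZ; last exact: bump_imf_cont.
rewrite -mulN1r -segintZ; last exact: ddbump_imf_cont.
apply: segint_cont_le.
- by move=> x; apply: cvgM; [exact: cvg_cst|exact: ddbump_imf_cont].
- by move=> x; apply: cvgM; [exact: cvg_cst|exact: bump_imf_cont].
by move=> x xI; rewrite mulN1r -mulNr [leRHS]mulrA ler_wpM2r ?imf_ge0// ddsmooth_bump_ge.
Qed.

Lemma mass_le_segint a y : 0 < a -> 0 < y ->
  mass a y <= segint (tau - a) (tau + a) (fun x => imf x y).
Proof.
move=> a0 y0; apply: segint_cont_le.
- exact: bump_imf_cont.
- exact: imf_cont.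
move=> x xI; rewrite -[leRHS]mul1r ler_wpM2r ?imf_ge0//.
by have /andP[] := smooth_bump01 tau a x a0 xI.
Qed.

(** The second derivative in y of the smoothed mass is at least - 6 M / a^2,
    because the one of the bump is at most 6 / a^2. *)
Lemma mass_chord a y z h M : 0 < a -> 0 < y -> y < z -> z < h ->
  (forall t, 0 < t -> t <= h ->
    segint (tau - a) (tau + a) (fun x => imf x t) <= M) ->
  mass a z <= mass a y + 6 * M / a ^+ 2 * y ^+ 2 / 2 +
    z * (M + 6 * M / a ^+ 2 * h ^+ 2 / 2) / (h - z).
Proof.
move=> a0 y0 yz zh HM.
have z0 := lt_trans y0 yz; have h0 := lt_trans z0 zh.
have M0 : 0 <= M.
  apply: le_trans (HM h h0 (lexx _)); apply: Rintegral_ge0 => x _; exact: imf_ge0.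
have massh : mass a h <= M.
  by apply: le_trans (HM h h0 (lexx _)); exact: mass_le_segint.
have s0 : 0 <= 6 * M / a ^+ 2 by rewrite divr_ge0 ?sqr_ge0// mulr_ge0.
have := almost_convex_chord (mass a) (dmass a) (ddmass a) (6 * M / a ^+ 2) y z h.
move=> /(_ _ _ _ s0 _ y0 yz zh) H.
apply: le_trans (H _ _ _ _) _.
- by move=> t t0; exact: is_derive_mass.
- by move=> t t0; exact: is_derive_dmass.
- by move=> t t0; exact: mass_ge0.
- move=> t t0 th; rewrite /ddmass lerN2.
  apply: (@le_trans _ _ (6 * a ^- 2 * segint (tau - a) (tau + a) (fun x => imf x t))).
    rewrite -segintZ; last exact: imf_cont.
    apply: segint_cont_le.
    + exact: ddbump_imf_cont.
    + by move=> x; apply: cvgM; [exact: cvg_cst|exact: imf_cont].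
    by move=> x xI; rewrite ler_wpM2r ?imf_ge0// ddsmooth_bump_le.
  have -> : 6 * M / a ^+ 2 = 6 * a ^- 2 * M by ring.
  by rewrite ler_wpM2l ?HM ?(ltW th)// mulr_ge0// invr_ge0 sqr_ge0.
rewrite lerD2l ler_wpM2r ?invr_ge0 ?subr_ge0 ?(ltW zh)//.
by rewrite ler_wpM2l ?(ltW z0)// lerD2r.
Qed.

Lemma segint_le_mass a y : 0 < a -> 0 < y ->
  segint (tau - a / 2) (tau + a / 2) (fun x => imf x y) <= 64 / 27 * mass a y.
Proof.
move=> a0 y0.
have ge0 x : tau - a <= x <= tau + a -> 0 <= smooth_bump tau a x * imf x y.
  move=> xI; rewrite mulr_ge0 ?imf_ge0//.
  by have /andP[] := smooth_bump01 tau a x a0 xI.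
have cont : continuous (fun x => smooth_bump tau a x * imf x y).
  by move=> x; apply: cvgM; [exact: bump_cont|exact: continuous_imf].
apply: (@le_trans _ _ (64 / 27 * segint (tau - a / 2) (tau + a / 2)
    (fun x => smooth_bump tau a x * imf x y))).
  rewrite -segintZ; last exact: continuous_subspaceT.
  apply: segint_cont_le.
  - exact: imf_cont.
  - by apply: continuous_subspaceT => x; apply: cvgM; [exact: cvg_cst|exact: cont].
  move=> x xI; rewrite mulrA -[leLHS]mul1r ler_wpM2r ?imf_ge0//.
  by have := smooth_bump_half_ge tau a x a0 xI; lra.
by rewrite ler_wpM2l//; apply: segint_sub_le; [lra|lra|lra|exact: bump_imf_cont|].
Qed.

End smoothed_mass.

(** * The boundary limit of the smoothed mass *)

Section cutoff.
Context {R : realType}.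
Variable tau : R.

(** The bump extended by 0, in the form of a composition of continuous functions
    on the line, to serve as a test function for weak convergence. *)
Definition cutoff (a x : R) : R :=
  Num.max 0 (1 - a ^- 2 * (x - tau) ^+ 2) ^+ 3.

Lemma cutoff_smooth_bump a x : 0 < a -> tau - a <= x <= tau + a ->
  cutoff a x = smooth_bump tau a x.
Proof.
move=> a0 /(bump_variable01 _ _ _ a0) /andP[_ h]; rewrite /cutoff /smooth_bump.
by rewrite max_r// subr_ge0.
Qed.

Lemma cutoff_out a x : 0 < a -> ~~ (tau - a < x < tau + a) -> cutoff a x = 0.
Proof.
move=> a0 xI; rewrite /cutoff max_l ?expr0n// subr_le0.
rewrite ler_pdivlMl ?exprn_gt0// mulr1 -[leLHS]real_normK ?num_real//.
rewrite -[leRHS]real_normK ?num_real// ler_sqr ?nnegrE// (gtr0_norm a0).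
rewrite leNgt; apply: contra xI; rewrite ltr_norml => /andP[h1 h2].
by apply/andP; split; lra.
Qed.

Lemma cutoff01 a x : 0 <= cutoff a x <= 1.
Proof.
have h : 0 <= a ^- 2 * (x - tau) ^+ 2.
  by rewrite mulr_ge0 ?sqr_ge0// invr_ge0 sqr_ge0.
have m0 : 0 <= Num.max 0 (1 - a ^- 2 * (x - tau) ^+ 2) by rewrite le_max lexx.
rewrite exprn_ge0//= exprn_ile1// ge_max ler01/=.
by rewrite gerBl.
Qed.

Lemma continuous_cutoff a : continuous (cutoff a).
Proof.
move=> x; apply: (@cvg_comp _ _ _ _ (fun t : R => t ^+ 3)); last exact: exprn_continuous.
apply: (@continuous_max R R (fun=> 0) (fun x => 1 - a ^- 2 * (x - tau) ^+ 2)).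
  exact: cvg_cst.
apply: cvgB; first exact: cvg_cst.
apply: cvgM; first exact: cvg_cst.
apply: (@cvg_comp _ _ _ (fun x => x - tau) (fun t : R => t ^+ 2)).
  by apply: cvgB; [exact: cvg_id|exact: cvg_cst].
exact: exprn_continuous.
Qed.

Lemma compactly_supported_cutoff a : 0 < a -> compactly_supported (cutoff a).
Proof.
move=> a0; apply: (subclosed_compact (@closed_closure _ _)
  (@segment_compact R (tau - a) (tau + a))).
have cl : closed (`[tau - a, tau + a] : set R) by exact: interval_closed.
rewrite [X in _ `<=` X](closure_id _).1//; apply: closureS => x /=.
apply: contra_neqT; rewrite in_itv/= => xI; apply: cutoff_out => //.
by apply: contra xI => /andP[/ltW -> /ltW ->].
Qed.

End cutoff.

Section boundary_mass.
Context {R : realType}.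
Variables (f : R[i] -> R[i]) (tau : R) (mu : {measure set (measurableTypeR R) -> \bar R}).
Hypothesis f_analytic : analytic_on upper_half_plane f.
Hypothesis f_maps :
  forall z : R[i], upper_half_plane z -> closed_upper_half_plane (f z).
Hypothesis mu_f : nevanlinna_measure f mu.

Definition boundary_mass (a : R) : R := fine (\int[mu]_x (cutoff tau a x)%:E).

Lemma boundary_massE a : 0 < a ->
  (\int[mu]_x (cutoff tau a x)%:E = (boundary_mass a)%:E)%E.
Proof.
move=> a0; rewrite /boundary_mass fineK//; apply: integrable_fin_num => //.
have [] // := mu_f (cutoff tau a).
  exact: continuous_cutoff.
exact: compactly_supported_cutoff.
Qed.

Let cutoff_measurable a :
  measurable_fun [set: measurableTypeR R] (EFin \o cutoff tau a).
Proof.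
apply/measurable_EFinP; apply: continuous_measurable_fun; exact: continuous_cutoff.
Qed.

Lemma boundary_mass_le a : 0 < a ->
  ((boundary_mass a)%:E <= mu `](tau - a)%R, (tau + a)%R[%classic)%E.
Proof.
move=> a0; rewrite -boundary_massE//.
rewrite -[X in (_ <= mu X)%E]setIT -(integral_indic mu)//.
apply: ge0_le_integral => //.
- by move=> x _; rewrite lee_fin; have /andP[] := cutoff01 tau a x.
- exact: cutoff_measurable.
- by apply/measurable_EFinP; exact: measurable_indic.
- move=> x _; rewrite lee_fin indicE.
  have [xI|xI] := boolP (x \in _); first by have /andP[] := cutoff01 tau a x.
  rewrite cutoff_out//; apply: contra xI => xI; rewrite inE/=.
  by rewrite in_itv.
Qed.

Lemma le_boundary_mass a : 0 < a ->
  (mu `](tau - a / 2)%R, (tau + a / 2)%R[%classic <=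
   (64 / 27 * boundary_mass a)%:E)%E.
Proof.
move=> a0; rewrite EFinM -boundary_massE//.
rewrite -[X in (mu X <= _)%E]setIT -(integral_indic mu)// -ge0_integralZl_EFin//.
- apply: ge0_le_integral => //.
  + by apply/measurable_EFinP; exact: measurable_indic.
  + by apply: measurable_funeM; exact: cutoff_measurable.
  move=> x _; rewrite -EFinM lee_fin indicE.
  have [|xI] := boolP (x \in _); last first.
    by rewrite mulr_ge0//; have /andP[] := cutoff01 tau a x.
  rewrite inE/= in_itv/= => /andP[h1 h2].
  rewrite cutoff_smooth_bump//; last by apply/andP; split; lra.
  have xI : tau - a / 2 <= x <= tau + a / 2 by rewrite !ltW.
  by have := smooth_bump_half_ge tau a x a0 xI; lra.
- by move=> x _; rewrite lee_fin; have /andP[] := cutoff01 tau a x.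
- exact: cutoff_measurable.
Qed.

Lemma integral_cutoff_mass a y : 0 < a -> 0 < y ->
  (\int[lebesgue_measure]_x (cutoff tau a x * complex.Im (f (x +i* y)))%:E =
   (mass f tau a y)%:E)%E.
Proof.
move=> a0 y0; rewrite /mass /segint /Rintegral fineK; last first.
  apply: integrable_fin_num => //; apply: segment_integrable.
  apply: continuous_subspaceT => x; apply: cvgM; last exact: continuous_imf.
  by apply: is_derive_continuous => z; exact: is_derive_smooth_bump.
rewrite [RHS]integral_mkcond; apply: eq_integral => x _.
rewrite patchE; case: ifPn => [|xI].
  by rewrite inE/= in_itv/= => xI; rewrite cutoff_smooth_bump.
rewrite cutoff_out ?mul0r//; apply: contra xI => /andP[h1 h2].
by rewrite inE/= in_itv/= !ltW.
Qed.

Lemma mass_cvg a : 0 < a -> mass f tau a y @[y --> 0^'+] --> boundary_mass a.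
Proof.
move=> a0; have [|int] := mu_f (cutoff tau a) (@continuous_cutoff _ tau a).
  exact: compactly_supported_cutoff.
rewrite boundary_massE// => /fine_cvgP[_]; apply: cvg_trans.
apply: near_eq_cvg; near=> y.
by rewrite /= integral_cutoff_mass.
Unshelve. all: by end_near. Qed.

Lemma boundary_mass_growth a z : 0 < a -> 0 < z ->
  boundary_mass a <= expR (3 / a * z) * mass f tau a z.
Proof.
move=> a0 z0; apply: (cvgr_to_le (mass_cvg a a0)).
near=> y; apply: mass_growth => //.
Unshelve. all: by end_near. Qed.

Lemma boundary_mass_chord a z h M : 0 < a -> 0 < z -> z < h ->
  (forall t, 0 < t -> t <= h ->
    segint (tau - a) (tau + a) (fun x => imf f x t) <= M) ->
  mass f tau a z <= boundary_mass a + z * (M + 6 * M / a ^+ 2 * h ^+ 2 / 2) / (h - z).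
Proof.
move=> a0 z0 zh HM.
have cv : (mass f tau a y + 6 * M / a ^+ 2 * y ^+ 2 / 2 +
    z * (M + 6 * M / a ^+ 2 * h ^+ 2 / 2) / (h - z)) @[y --> 0^'+] -->
    boundary_mass a + 6 * M / a ^+ 2 * 0 ^+ 2 / 2 +
    z * (M + 6 * M / a ^+ 2 * h ^+ 2 / 2) / (h - z).
  apply: cvgD; last exact: cvg_cst.
  apply: cvgD; first exact: mass_cvg.
  apply: cvgM; last exact: cvg_cst.
  apply: cvgM; first exact: cvg_cst.
  apply: (@cvg_comp _ _ _ id (fun t : R => t ^+ 2) _ (nbhs 0)).
    exact: cvg_within.
  exact: exprn_continuous.
move: cv; rewrite expr0n/= mulr0 mul0r addr0 => cv.
apply: (cvgr_to_ge cv).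
near=> y; apply: mass_chord => //.
Unshelve. all: by end_near. Qed.

(** The bump of radius 2 is at least 27/64 on [tau - 1, tau + 1], and its
    smoothed mass converges at the boundary. *)
Lemma segint_bounded : exists r M : R, [/\ 0 < r, 0 <= M &
  forall t, 0 < t -> t <= r ->
    segint (tau - 1) (tau + 1) (fun x => imf f x t) <= M].
Proof.
have cv := mass_cvg 2 (ltr0Sn _ _).
have : \forall y \near 0^'+, mass f tau 2 y <= boundary_mass 2 + 1.
  by apply: (cvgr_le _ cv); rewrite ltrDl.
rewrite /at_right /within /= => /nbhs_ballP[r /= r0 H].
exists (r / 2), (64 / 27 * (boundary_mass 2 + 1)); split.
- by rewrite divr_gt0.
- have r20 : 0 < r / 2 by rewrite divr_gt0.
  rewrite mulr_ge0// (le_trans (mass_ge0 f tau f_maps 2 (r / 2) _ r20))// H//.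
  by rewrite /ball/= sub0r normrN gtr0_norm// ltr_pdivrMr// ltr_pMr// ltr1n.
move=> t t0 tr.
have := segint_le_mass f tau f_analytic f_maps 2 t (ltr0Sn _ _) t0.
rewrite divff// => /le_trans; apply; rewrite ler_wpM2l// H//.
by rewrite /ball/= sub0r normrN gtr0_norm// (le_lt_trans tr)// ltr_pdivrMr// ltr_pMr// ltr1n.
Qed.

End boundary_mass.

(** * Fortunate functions and sub-densities *)

Section right_neighbourhoods.
Context {R : realType}.

Lemma near_at_right0P (P : R -> Prop) :
  (\forall e \near 0^'+, P e) <->
  exists2 d : R, 0 < d & forall e, 0 < e -> e < d -> P e.
Proof.
split.
  rewrite /at_right /within /= => /nbhs_ballP[d /= d0 H]; exists d => // e e0 ed.
  by apply: H => //; rewrite /ball/= sub0r normrN gtr0_norm.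
move=> [d d0 H]; rewrite /at_right /within /=; apply/nbhs_ballP; exists d => //= e.
by rewrite /ball/= sub0r normrN => ed e0; apply: H => //; rewrite -(gtr0_norm e0).
Qed.

Lemma limf_esup_at_right_ltyP (F : R -> \bar R) :
  (limf_esup F 0^'+ < +oo)%E <->
  exists M d : R, 0 < d /\ forall e, 0 < e -> e < d -> (F e <= M%:E)%E.
Proof.
split.
  rewrite limf_esupE => /ereal_inf_lt[_ [V FV <-]] supV.
  have [d d0 H] := (near_at_right0P V).1 FV.
  exists (fine (ereal_sup (F @` V))), d; split => // e e0 ed.
  apply: (@le_trans _ _ (ereal_sup (F @` V))).
    by apply: ereal_sup_ubound; exists e => //; exact: H.
  by case: (ereal_sup _) supV => //=; rewrite ?leNye.
move=> [M [d [d0 H]]]; rewrite limf_esupE.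
apply: (@le_lt_trans _ _ M%:E); last exact: ltry.
apply: ge_ereal_inf; exists (ereal_sup (F @` [set e | F e <= M%:E]%E)).
  exists [set e | F e <= M%:E]%E => //.
  by apply: (near_at_right0P (fun e => F e <= M%:E)%E).2; exists d.
by apply: ge_ereal_sup => _ [e /= h <-].
Qed.

Lemma bounded_near_at_right (g : R -> R^o) : bounded_near g 0^'+ ->
  exists M d : R, [/\ 0 < M, 0 < d & forall e, 0 < e -> e < d -> `|g e| <= M].
Proof.
by move=> /pinfty_ex_gt0[M M0 /near_at_right0P[d d0 H]]; exists M, d.
Qed.

End right_neighbourhoods.

Section translation.
Context {R : realType}.

Lemma segint_shift (tau a b : R) (g : R -> R) : a < b -> continuous g ->
  segint a b (fun x => g (tau + x)) = segint (tau + a) (tau + b) g.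
Proof.
move=> ab cg; pose F x := segint (tau + a - 1) (tau + x) g.
have sh (x : R) : is_derive x 1 (fun x : R => tau + x) 1.
  have -> : (fun x : R => tau + x) = cst tau + id by [].
  by apply: is_derive_eq; rewrite add0r.
have dF (x : R) : a <= x -> is_derive x 1 F (g (tau + x)).
  move=> ax; rewrite -[g _]mulr1.
  apply: (@is_derive1_comp _ (fun t => segint (tau + a - 1) t g)
    (fun x : R => tau + x) x _ _ _ (sh x)).
  apply: is_derive_segint => //.
  by rewrite ltrBlDr -addrA ltrD2l (le_lt_trans ax)// ltrDl.
have cF x : a <= x -> {for x, continuous F}.
  by move=> ax; apply/differentiable_continuous/derivable1_diffP; have [] := dF x ax.
have csh : continuous (fun x => g (tau + x)).
  move=> x; apply: (@cvg_comp _ _ _ (fun x => tau + x) g); last exact: cg.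
  by apply: cvgD; [exact: cvg_cst|exact: cvg_id].
rewrite /segint /Rintegral (@continuous_FTC2 R (fun x => g (tau + x)) F)//=.
- rewrite -/(segint _ _ _) /F (@segint_chasles _ _ (tau + a) (tau + b))//.
  + by rewrite addrAC subrr add0r.
  + by rewrite lerBlDr lerDl ler01/= lerD2l ltW.
  + exact: continuous_subspaceT.
- exact: continuous_subspaceT.
- split=> [x||].
  + by rewrite in_itv/= => /andP[ax _]; have [] := dF x (ltW ax).
  + by apply: cvg_at_right_filter; exact: cF.
  + by apply: cvg_at_left_filter; exact: cF (ltW ab).
- by move=> x; rewrite in_itv/= => /andP[ax _]; rewrite derive1E; have [] := dF x (ltW ax).
Qed.

End translation.

Section fortune.
Context {R : realType}.
Variables (Phi : R -> R) (f : R[i] -> R[i]) (tau : R).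
Variable mu : {measure set (measurableTypeR R) -> \bar R}.
Hypothesis Phi_pos : positive_fun Phi.
Hypothesis f_analytic : analytic_on upper_half_plane f.
Hypothesis f_maps :
  forall z : R[i], upper_half_plane z -> closed_upper_half_plane (f z).
Hypothesis mu_f : nevanlinna_measure f mu.

Lemma AfF_segint (k lambda : R -> R) e : 0 < e -> positive_fun lambda ->
  AfF k lambda f tau e =
  ((2 * e)^-1 * (segint (tau - e) (tau + e) (fun x => imf f x (lambda e)) /
    k (lambda e)))%:E.
Proof.
move=> e0 /(_ _ e0) l0; rewrite /AfF EFinM; congr (_ * _)%E.
have cI := continuous_imf f f_analytic _ l0.
have csh : continuous (fun x => imf f (tau + x) (lambda e)).
  move=> x; apply: (@cvg_comp _ _ _ (fun x => tau + x) (fun x => imf f x (lambda e))).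
    by apply: cvgD; [exact: cvg_cst|exact: cvg_id].
  exact: cI.
rewrite -(segint_shift tau (- e) e (fun x => imf f x (lambda e)))//; last first.
  by rewrite (lt_trans _ e0)// oppr_lt0.
rewrite mulrC -segintZ; last exact: continuous_subspaceT.
rewrite /segint /Rintegral fineK.
  by apply: eq_integral => x _; rewrite /fF /imf mulrC.
apply: integrable_fin_num => //; apply: segment_integrable.
by apply: continuous_subspaceT => x; apply: cvgM; [exact: cvg_cst|exact: csh].
Qed.

(** The bump of radius e is bounded below only on the half interval, whence the
    density is estimated at e' = e / 2 and the constant C is doubled. *)
Lemma fortunate_sub_density : fortunate Phi f tau -> sub_density Phi mu tau.
Proof.
move=> [C [k [lambda [[C0 k0 l0] [Phik [K [d1 [K0 d10 lK]]] _ fin]]]]].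
have /limf_esup_at_right_ltyP[M [d2 [d20 AM]]] := fin.
exists (2 * C); first by rewrite mulr_gt0.
exists (64 / 27 * (expR (3 * K) * (4 * M))); apply/near_at_right0P.
exists (Num.min d1 d2 / 2); first by rewrite divr_gt0// lt_min d10.
move=> e' e'0; rewrite ltr_pdivlMr// mulrC lt_min => /andP[ed1 ed2].
have [e eE] : exists e, e = 2 * e' by eexists.
rewrite -eE in ed1 ed2; have e0 : 0 < e by rewrite eE mulr_gt0.
have e'E : e' = e / 2 by rewrite eE; field.
have Ce : 2 * C * e' = C * e by rewrite eE; ring.
have P0 : 0 < Phi (C * e) by apply: Phi_pos; rewrite mulr_gt0.
have le0 := l0 _ e0.
have leK : lambda e <= K * e by apply: lK; rewrite e0.
have := AM e e0 ed2; rewrite AfF_segint// -Phik// lee_fin => H.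
have seg : segint (tau - e) (tau + e) (fun x => imf f x (lambda e)) <=
    2 * M * (e * Phi (C * e)).
  move: H; rewrite ler_pdivrMl ?mulr_gt0// ler_pdivrMr//.
  by congr (_ <= _); ring.
have bm : boundary_mass tau mu e <= expR (3 * K) * (2 * M * (e * Phi (C * e))).
  apply: le_trans (boundary_mass_growth _ _ _ f_analytic f_maps mu_f e (lambda e) e0 le0) _.
  apply: ler_pM => //.
  - exact: mass_ge0.
  - by rewrite ler_expR mulrAC ler_pdivrMr// -mulrA ler_pM2l.
  - exact: le_trans (mass_le_segint _ _ f_analytic f_maps _ _ e0 le0) seg.
have e1 : 0 < (Phi (C * e) * e')^-1 by rewrite invr_gt0 mulr_gt0.
rewrite Ce e'E -e'E.
apply: (@le_trans _ _ ((64 / 27 * boundary_mass tau mu e)%:E * ((Phi (C * e) * e')^-1)%:E)%E).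
  apply: lee_wpmul2r; first by rewrite lee_fin ltW.
  by rewrite e'E; exact: (le_boundary_mass f).
rewrite -EFinM lee_fin ler_pdivrMr ?mulr_gt0//.
rewrite -[leRHS]mulrA ler_wpM2l//; apply: le_trans bm _; rewrite -[leRHS]mulrA ler_wpM2l ?expR_ge0//.
by rewrite eE le_eqVlt; apply/orP; left; apply/eqP; ring.
Qed.

(** The bump that dominates [tau - e, tau + e] has radius 2 e, so the density is
    used at 2 e and the constant is again doubled. The chord goes up to
    h = (K + 1) e, where lambda(e) <= K e: this is of the order of the radius and
    leaves h - lambda(e) >= e. *)
Lemma sub_density_limsup : sub_density Phi mu tau ->
   exists2 C : R, 0 < C &
     forall k lambda : R -> R, positive_fun k -> positive_fun lambda ->
       (forall t : R, 0 < t -> Phi (C * t) = k (lambda t)) ->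
       lambda_ratio_bounded Phi C lambda ->
       is_Ot lambda ->
       limsup_AfF_finite k lambda f tau.
Proof.
move=> [C0 C00 [M0 /near_at_right0P[d0 d00 dens]]].
exists (2 * C0); first by rewrite mulr_gt0.
move=> k lambda k0 l0 Phik /bounded_near_at_right[M1 [d1 [M10 d10 ratio]]].
move=> [K [d2 [K0 d20 lK]]].
have [r [M [r0 M_ge0 bnd]]] := segint_bounded f tau mu f_analytic f_maps mu_f.
pose M2 := M * (1 + 3 / 4 * (K + 1) ^+ 2).
have M20 : 0 <= M2.
  by rewrite mulr_ge0// addr_ge0// mulr_ge0// sqr_ge0.
apply/limf_esup_at_right_ltyP.
have K1 : 0 < K + 1 by rewrite addr_gt0.
exists (64 / 27 * (M0 + M2 * M1 / 2)).
exists (Num.min (Num.min (1 / 2) (d0 / 2)) (Num.min (Num.min d1 d2) (r / (K + 1)))).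
split; first by rewrite !lt_min d10 d20 !divr_gt0.
move=> e e0; rewrite !lt_min => /andP[/andP[e12 ed0] /andP[/andP[ed1 ed2] er]].
have le0 := l0 _ e0.
have P0 : 0 < Phi (2 * C0 * e) by apply: Phi_pos; rewrite !mulr_gt0.
have leK : lambda e <= K * e by apply: lK; rewrite e0.
have a0 : 0 < 2 * e by rewrite mulr_gt0.
have hr : (K + 1) * e <= r by rewrite mulrC -ler_pdivlMr// ltW.
have zh : lambda e < (K + 1) * e by rewrite (le_lt_trans leK)// mulrDl mul1r ltrDl.
have hz : e <= (K + 1) * e - lambda e by rewrite mulrDl mul1r; lra.
have bnd2 t : 0 < t -> t <= (K + 1) * e ->
    segint (tau - 2 * e) (tau + 2 * e) (fun x => imf f x t) <= M.
  move=> t0 th; apply: le_trans (bnd t t0 (le_trans th hr)).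
  apply: segint_sub_le; [lra|lra|lra| |by move=> x _; exact: imf_ge0].
  by apply: continuous_subspaceT; exact: continuous_imf.
have chord := boundary_mass_chord f tau mu f_analytic f_maps mu_f (2 * e) (lambda e)
  ((K + 1) * e) M a0 le0 zh bnd2.
have bm : boundary_mass tau mu (2 * e) <= 2 * M0 * (e * Phi (2 * C0 * e)).
  have := dens (2 * e) a0; rewrite mulrC -ltr_pdivlMr// => /(_ ed0).
  have CE : C0 * (e * 2) = 2 * C0 * e by ring.
  rewrite CE => D.
  have pos : 0 < Phi (2 * C0 * e) * (e * 2) by rewrite !mulr_gt0.
  have : ((boundary_mass tau mu (e * 2))%:E * ((Phi (2 * C0 * e) * (e * 2))^-1)%:E <= M0%:E)%E.
    apply: le_trans D; apply: lee_wpmul2r; first by rewrite lee_fin invr_ge0 ltW.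
    by apply: (boundary_mass_le f) => //; rewrite mulrC.
  rewrite -EFinM lee_fin ler_pdivrMr// => /le_trans; apply.
  by rewrite le_eqVlt; apply/orP; left; apply/eqP; ring.
have tail : lambda e * (M + 6 * M / (2 * e) ^+ 2 * ((K + 1) * e) ^+ 2 / 2) /
    ((K + 1) * e - lambda e) <= M2 * (lambda e / e).
  have -> : M + 6 * M / (2 * e) ^+ 2 * ((K + 1) * e) ^+ 2 / 2 = M2.
    by rewrite /M2; field; rewrite gt_eqF.
  rewrite [lambda e * M2]mulrC -mulrA ler_wpM2l// ler_pM2l// lef_pV2// posrE//.
  exact: lt_le_trans hz.
have rat : lambda e / e <= M1 * (e * Phi (2 * C0 * e)).
  have := ratio e e0 ed1; rewrite ger0_norm; last first.
    by rewrite divr_ge0 ?(ltW le0)// mulr_ge0 ?sqr_ge0// ltW.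
  rewrite ler_pdivrMr ?mulr_gt0// ?exprn_gt0// => h; rewrite ler_pdivrMr//.
  by apply: le_trans h _; rewrite le_eqVlt; apply/orP; left; apply/eqP; ring.
have seg := segint_le_mass f tau f_analytic f_maps (2 * e) (lambda e) a0 le0.
rewrite AfF_segint// -Phik// lee_fin ler_pdivrMl// ler_pdivrMr//.
have eE : 2 * e / 2 = e by field.
rewrite eE in seg; apply: le_trans seg _.
have M2rat : M2 * (lambda e / e) <= M2 * (M1 * (e * Phi (2 * C0 * e))).
  by rewrite ler_wpM2l.
have step := le_trans chord (lerD bm (le_trans tail M2rat)).
have -> : 2 * e * (64 / 27 * (M0 + M2 * M1 / 2)) * Phi (2 * C0 * e) =
  64 / 27 * (2 * M0 * (e * Phi (2 * C0 * e)) + M2 * (M1 * (e * Phi (2 * C0 * e)))).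
  by field.
by rewrite ler_wpM2l.
Qed.

(** The reciprocal of lambda is the integer n(t) + 1, where n(t) >= 1 / g(t), plus
    the fractional part t / (1 + t), from which t can be read off. *)
Lemma injective_minorant (g : R -> R) : positive_fun g ->
  exists2 lambda : R -> R, positive_fun lambda &
    (forall t, 0 < t -> lambda t <= g t) /\
    (forall s t, 0 < s -> 0 < t -> lambda s = lambda t -> s = t).
Proof.
move=> g0; pose n t := Num.bound (g t)^-1; pose h (t : R) := t / (1 + t).
have hP t : 0 < t -> 0 <= h t /\ h t < 1.
  move=> t0; have t1 : 0 < 1 + t by rewrite addr_gt0.
  by rewrite /h divr_ge0 ?(ltW t0) ?(ltW t1)// ltr_pdivrMr// mul1r ltrDr.
have den t : 0 < t -> 0 < (n t)%:R + 1 + h t.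
  by move=> /hP[h0 _]; rewrite ltr_wpDr// ltr_wpDl.
exists (fun t => ((n t)%:R + 1 + h t)^-1).
  by move=> t t0; rewrite invr_gt0 den.
split=> [t t0|s t s0 t0 /invr_inj].
  rewrite -[leRHS]invrK lef_pV2 ?posrE ?invr_gt0 ?g0 ?den//.
  have b : (g t)^-1 < (n t)%:R by apply: archi_boundP; rewrite invr_ge0 ltW// g0.
  by have [h0 _] := hP t t0; rewrite -addrA (le_trans (ltW b))// lerDl addr_ge0.
rewrite ![_%:R + 1 + _]addrAC => /addIr e.
have [hs0 hs1] := hP s s0; have [ht0 ht1] := hP t t0.
have nE : n s = n t.
  apply/eqP; rewrite eqn_leq; apply/andP; split; rewrite leqNgt; apply/negP.
    by rewrite -(ler_nat R) -natr1; lra.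
  by rewrite -(ler_nat R) -natr1; lra.
move: e; rewrite nE => /addrI; rewrite /h => /eqP.
rewrite eqr_div; try by apply: lt0r_neq0; rewrite addr_gt0.
move=> /eqP.
by rewrite !mulrDr !mulr1 [s * t]mulrC => /addIr.
Qed.

(** With lambda injective, k is Phi(C .) composed with the inverse of lambda;
    its values off the range of lambda are set to 1. *)
Lemma sub_density_fortunate : sub_density Phi mu tau -> fortunate Phi f tau.
Proof.
move=> /sub_density_limsup[C C0 H].
have PC t : 0 < t -> 0 < Phi (C * t) by move=> t0; apply: Phi_pos; rewrite mulr_gt0.
have [|lambda l0 [lle linj]] :=
    injective_minorant (fun t => Num.min t (Phi (C * t) * t ^+ 2)).
  by move=> t t0; rewrite lt_min t0 mulr_gt0 ?PC// exprn_gt0.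
pose preim y := xget 0 [set t | 0 < t /\ lambda t = y].
pose k y := if 0 < preim y then Phi (C * preim y) else 1.
have preimE t : 0 < t -> preim (lambda t) = t.
  by move=> t0; apply: xget_unique => // s [s0 /linj]; exact.
have k0 : positive_fun k by move=> y _; rewrite /k; case: ifPn => // /PC.
have kE t : 0 < t -> Phi (C * t) = k (lambda t).
  by move=> t0; rewrite /k preimE// t0.
have lO : is_Ot lambda.
  exists 1, 1; split => // t /andP[t0 _]; rewrite mul1r.
  by rewrite (le_trans (lle t t0))// ge_min lexx.
have lb : lambda_ratio_bounded Phi C lambda.
  rewrite /lambda_ratio_bounded /bounded_near; near=> M.
  apply/near_at_right0P; exists 1 => // e e0 _ /=.
  have p0 : 0 < Phi (C * e) * e ^+ 2 by rewrite mulr_gt0 ?PC// exprn_gt0.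
  rewrite ger0_norm; last by rewrite divr_ge0 ?(ltW p0)// ltW// l0.
  apply: (@le_trans _ _ 1); last by near: M; apply: nbhs_pinfty_ge; rewrite num_real.
  by rewrite ler_pdivrMr// mul1r (le_trans (lle e e0))// ge_min lexx orbT.
by exists C, k, lambda; split; split => //; exact: H.
Unshelve. all: by end_near. Qed.

End fortune.

Theorem corollary2p3 (R : realType) (Phi : R -> R) (f : R[i] -> R[i]) (tau : R)
    (mu : {measure set (measurableTypeR R) -> \bar R})
    (Phi_pos : positive_fun Phi)
    (f_analytic : analytic_on upper_half_plane f)
    (f_maps : forall z : R[i], upper_half_plane z -> closed_upper_half_plane (f z))
    (mu_f : nevanlinna_measure f mu) :
  (fortunate Phi f tau <-> sub_density Phi mu tau) /\
  (fortunate Phi f tau ->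
   exists2 C : R, 0 < C &
     forall k lambda : R -> R, positive_fun k -> positive_fun lambda ->
       (forall t : R, 0 < t -> Phi (C * t) = k (lambda t)) ->
       lambda_ratio_bounded Phi C lambda ->
       is_Ot lambda ->
       limsup_AfF_finite k lambda f tau).
Proof.
have fs := @fortunate_sub_density R Phi f tau mu Phi_pos f_analytic f_maps mu_f.
split; last by move=> /fs; exact: sub_density_limsup.
by split => //; exact: sub_density_fortunate.
Qed.
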